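(* Let $X=\{X(t),t\in\mathbb{R}^N\}$ be a real-valued centered Gaussian random field, $p\ge1$ an integer, and $\mathbf{X}(t)=(X_1(t),\dots,X_p(t))$, $t\in\mathbb{R}^N$, where $X_1,\dots,X_p$ are independent copies of $X$. Let $0<\overline H_1\le\overline H_2\le\dots\le\overline H_N\le1$. Suppose there exist constants $\delta_0>0$ and $c_{11}\ge1$ such that for all $s,t\in[0,1]^N$ with $|s-t|\le\delta_0$, $$c_{11}^{-1}\sum_{j=1}^N|s_j-t_j|^{2\overline H_j}\le\mathbb{E}\big[(X(t)-X(s))^2\big]\le c_{11}\sum_{j=1}^N|s_j-t_j|^{2\overline H_j}.$$ Then, with probability $1$, $$\dim\mathbf{X}\big([0,1]^N\big)=\min\Big\{p,\ \sum_{j=1}^N\frac1{\overline H_j}\Big\}$$ and $$\dim\mathrm{Gr}\,\mathbf{X}\big([0,1]^N\big)=\min\bigg\{\min_{1\le k\le N}\Big[\sum_{j=1}^k\frac{\overline H_k}{\overline H_j}+N-k+(1-\overline H_k)p\Big],\ \sum_{j=1}^N\frac1{\overline H_j}\bigg\}.$$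
   Context: $\dim$ denotes Hausdorff dimension (with respect to Euclidean distance). $\mathbf{X}([0,1]^N)=\{\mathbf{X}(t):t\in[0,1]^N\}\subset\mathbb{R}^p$ is the range and $\mathrm{Gr}\,\mathbf{X}([0,1]^N)=\{(t,\mathbf{X}(t)):t\in[0,1]^N\}\subset\mathbb{R}^{N+p}$ is the graph. Sample functions $t\mapsto X(t)$ are assumed almost surely continuous. *)

(* Defs.v *)
From HB Require Import structures.
From mathcomp Require Import all_boot all_order all_algebra.
From mathcomp Require Import all_classical all_reals all_analysis.

Set Implicit Arguments.
Unset Strict Implicit.
Unset Printing Implicit Defensive.

Import Order.TTheory GRing.Theory Num.Theory.
Import numFieldNormedType.Exports.

Local Open Scope classical_set_scope.
Local Open Scope ring_scope.

(* The library norm on ['rV[R]_n] is the sup norm, hence this definition. *)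
Definition euclid_dist (R : realType) (n : nat) (x y : 'rV[R]_n) : R :=
  Num.sqrt (\sum_(i < n) (x 0 i - y 0 i) ^+ 2).

Definition unit_cube (R : realType) (N : nat) : set 'rV[R]_N :=
  [set t | forall j : 'I_N, 0 <= t 0 j <= 1].

(* Equal to -oo on the empty set. *)
Definition diam (R : realType) (n : nat) (U : set 'rV[R]_n) : \bar R :=
  ereal_sup [set (euclid_dist x y)%:E | x in U & y in U].

(* diam(U)^s, where the empty set counts for 0 and diam(U)^0 = 1 otherwise, so
   that the 0-dimensional Hausdorff measure is the counting measure. *)
Definition diam_pow (R : realType) (n : nat) (s : R) (U : set 'rV[R]_n) :
    \bar R :=
  if `[< U = set0 >] then 0%E else poweR (diam U) s.

Definition hausdorff_premeasure (R : realType) (n : nat) (s delta : R)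
    (A : set 'rV[R]_n) : \bar R :=
  ereal_inf [set (\sum_(0 <= i <oo) diam_pow s (U i))%E |
    U in [set U : nat -> set 'rV[R]_n |
      A `<=` \bigcup_i U i /\ forall i, (diam (U i) <= delta%:E)%E]].

(* The limit as delta decreases to 0 is a supremum, by monotonicity in delta. *)
Definition hausdorff_measure (R : realType) (n : nat) (s : R)
    (A : set 'rV[R]_n) : \bar R :=
  ereal_sup [set hausdorff_premeasure s delta A |
    delta in [set delta : R | 0 < delta]].

Definition hausdorff_dim (R : realType) (n : nat) (A : set 'rV[R]_n) : \bar R :=
  ereal_inf [set s%:E | s in
    [set s : R | 0 <= s /\ hausdorff_measure s A = 0%E]].

(* The normal law with mean m and variance sigma^2, the Dirac mass at m when
   sigma = 0: the library's [normal_prob m 0] is the uniform law on [0, 1]. *)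
Definition gaussian_law (R : realType) (m sigma : R) (B : set R) : \bar R :=
  if sigma == 0 then \d_m B else normal_prob m sigma B.

Definition is_gaussian (d : measure_display) (T : measurableType d)
    (R : realType) (P : probability T R) (Y : T -> R) : Prop :=
  exists m sigma : R, 0 <= sigma /\
    forall B : set R, measurable B -> P (Y @^-1` B) = gaussian_law m sigma B.

(* All finite-dimensional distributions are Gaussian vectors, i.e. every finite
   linear combination of the values of the field is a Gaussian variable. *)
Definition gaussian_field (d : measure_display) (T : measurableType d)
    (R : realType) (P : probability T R) (N : nat)
    (X : 'rV[R]_N -> {RV P >-> R}) : Prop :=
  forall (n : nat) (t : 'I_n -> 'rV[R]_N) (a : 'I_n -> R),
    is_gaussian P (fun w => \sum_(i < n) a i * X (t i) w).

Definition centered_field (d : measure_display) (T : measurableType d)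
    (R : realType) (P : probability T R) (N : nat)
    (X : 'rV[R]_N -> {RV P >-> R}) : Prop :=
  forall t, ('E_P[X t] = 0)%E.

Definition sample_path (d : measure_display) (T : measurableType d)
    (R : realType) (P : probability T R) (N : nat)
    (X : 'rV[R]_N -> {RV P >-> R}) (w : T) : 'rV[R]_N -> R :=
  fun t => X t w.

Definition continuous_field (d : measure_display) (T : measurableType d)
    (R : realType) (P : probability T R) (N : nat)
    (X : 'rV[R]_N -> {RV P >-> R}) : Prop :=
  {ae P, forall w, continuous (sample_path X w)}.

(* The product sigma-algebra on the space of all functions R^N -> R. *)
Definition path_measurable (R : realType) (N : nat) :
    set (set ('rV[R]_N -> R)) :=
  <<s [set C | exists t (B : set R),
         measurable B /\ C = [set f | B (f t)]] >>.

Definition same_law (d d' : measure_display) (T : measurableType d)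
    (T' : measurableType d') (R : realType)
    (P : probability T R) (P' : probability T' R) (N : nat)
    (X : 'rV[R]_N -> {RV P >-> R}) (X' : 'rV[R]_N -> {RV P' >-> R}) : Prop :=
  forall C, path_measurable C ->
    P (sample_path X @^-1` C) = P' (sample_path X' @^-1` C).

Definition independent_fields (d : measure_display) (T : measurableType d)
    (R : realType) (P : probability T R) (N p : nat)
    (Xs : 'I_p -> 'rV[R]_N -> {RV P >-> R}) : Prop :=
  forall (J : {set 'I_p}) (C : 'I_p -> set ('rV[R]_N -> R)),
    (forall i, i \in J -> path_measurable (C i)) ->
    fine (P (\bigcap_(i in [set` J]) (sample_path (Xs i) @^-1` C i))) =
    \prod_(i in J) fine (P (sample_path (Xs i) @^-1` C i)).

Definition vector_field (d : measure_display) (T : measurableType d)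
    (R : realType) (P : probability T R) (N p : nat)
    (Xs : 'I_p -> 'rV[R]_N -> {RV P >-> R}) (w : T) (t : 'rV[R]_N) : 'rV[R]_p :=
  \row_(i < p) Xs i t w.

Definition graph_on (R : realType) (N p : nat) (f : 'rV[R]_N -> 'rV[R]_p)
    (A : set 'rV[R]_N) : set 'rV[R]_(N + p) :=
  [set row_mx t (f t) | t in A].

Definition aniso_sum (R : realType) (N : nat) (H : 'I_N -> R)
    (s t : 'rV[R]_N) : R :=
  \sum_(j < N) `|s 0 j - t 0 j| `^ (2 * H j).

(* Main.v *)
(* Let [g(theta) = \sum_j max(L, theta / H_j) + (1 - theta) p], with [L = 0] for
   the range and [L = 1] for the graph; both dimensions are the minimum of [g]
   over [[0, 1]]. The function [g] is convex and piecewise affine, with breaks at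
   the [H_k], whence the explicit formulas.

   Upper bound. Chaining along anisotropic grids of side about [2^(-m/H_j)] and
   the Gaussian tails show that almost surely each coordinate field oscillates by
   at most [C 2^(-m(1-eps))] on the cells of level [m]. At scale [2^-n], cut the
   cube into cells of sides [min(2^(-Ln), 2^(-m/H_j))] with [m ~ theta n], and
   their images into cubes of side [2^-n]: about [2^(n g(theta))] pieces suffice.

   Lower bound. Mass is spread uniformly on finite grids, so that no Lebesgue
   measure on the cube is needed. Since [P(|X(s) - X(t)| <= r)] is at most
   [C r / rho(s, t)], where [rho(s, t) = max_j |s_j - t_j|^(H_j)], sorting the
   pairs of grid points by [rho(s, t) ~ 2^(k-n)] bounds the expected proportion
   of pairs with images at distance at most [2^-n] by [(n+1) 2^(-n min g)]. By
   Fatou's lemma the discrete [gamma]-energies stay bounded along a subsequence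
   of grids for every [gamma < min g], which forbids cheap covers. *)

Require Import Defs.
From HB Require Import structures.
From mathcomp Require Import all_boot all_order all_algebra.
From mathcomp Require Import all_classical all_reals all_analysis.
From mathcomp Require Import measurable_realfun ring lra zify.
Set Implicit Arguments.
Unset Strict Implicit.
Unset Printing Implicit Defensive.
Import Order.TTheory GRing.Theory Num.Theory.
Import numFieldNormedType.Exports.
Local Open Scope classical_set_scope.
Local Open Scope ring_scope.

(** * Powers of two *)

Section powers_of_two.
Variable R : realType.
Implicit Types (x y e r d gamma : R) (n k m : nat).

Lemma powR2N n : 2 ^- n = 2 `^ (- n%:R) :> R.
Proof. by rewrite powRN powR_mulrn. Qed.

Lemma powR2D x y : 2 `^ (x + y) = 2 `^ x * 2 `^ y :> R.
Proof. by rewrite powRD// pnatr_eq0 implybT. Qed.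

Lemma powR2_sum (I : finType) (F : I -> R) :
  2 `^ (\sum_i F i) = \prod_i 2 `^ (F i) :> R.
Proof.
by elim/big_rec2: _ => [|j y1 y2 _ <-]; rewrite ?powRr0// powR2D.
Qed.

Lemma powR2_ge1 x : 0 <= x -> 1 <= 2 `^ x.
Proof. by move=> x0; rewrite -{1}(powRr0 2) ler_powR// ler1n. Qed.

Lemma powR2_lt1 x : x < 0 -> 2 `^ x < 1.
Proof.
move=> x0; rewrite -[x]opprK powRN invf_lt1 ?powR_gt0//.
have xN0 : 0 < - x by rewrite oppr_gt0.
have := @gt0_ltr_powR _ _ xN0 1 2; rewrite !nnegrE powR1; apply => //.
by rewrite ltr1n.
Qed.

Lemma exists_pow2N_lt r : 0 < r -> exists n, 2 ^- n < r.
Proof.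
move=> r0; exists (Num.truncn r^-1).+1.
rewrite -[ltRHS]invrK ltf_pV2 ?posrE ?exprn_gt0 ?invr_gt0//.
apply: lt_le_trans (truncnS_gt _) _.
by rewrite -natrX ler_nat ltnW// ltn_expl.
Qed.

Lemma sum_half_powers k : \sum_(j < k) 2 ^- j.+1 <= 1 :> R.
Proof.
suff -> : \sum_(j < k) 2 ^- j.+1 = 1 - 2 ^- k :> R
  by rewrite gerBl invr_ge0 exprn_ge0.
elim: k => [|k IH]; first by rewrite big_ord0 expr0 invr1 subrr.
rewrite big_ord_recr/= IH exprS invfM; lra.
Qed.

(** The right-hand side is the value of the full series. The scale [n] contributes at most a
    multiple of [(n + 1) x^n] to the expected energy, with [x = 2^(gamma - D0)]. *)
Lemma sum_arith_geometric x m : 0 <= x < 1 ->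
  \sum_(n < m) n.+1%:R * x ^+ n <= (1 - x) ^- 2.
Proof.
move=> /andP[x0 x1]; have x10 : 0 < 1 - x by rewrite subr_gt0.
rewrite -[leRHS]mul1r ler_pdivlMr ?exprn_gt0//.
have -> : (\sum_(n < m) n.+1%:R * x ^+ n) * (1 - x) ^+ 2 =
    1 - x ^+ m * (1 + m%:R * (1 - x)).
  elim: m => [|m IH]; first by rewrite big_ord0 expr0; ring.
  rewrite big_ord_recr/= mulrDl IH [x ^+ m.+1]exprS -natr1; ring.
by rewrite gerBl mulr_ge0 ?exprn_ge0// addr_ge0 ?mulr_ge0// ltW.
Qed.

Lemma dyadic_scale d : 0 < d < 1 -> exists n, d < 2 ^- n <= 2 * d.
Proof.
move=> /andP[d0 d1].
have ex : exists n, 2 ^- n.+1 <= d.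
  have [n nd] := exists_pow2N_lt d0; exists n; apply: le_trans (ltW nd).
  by rewrite lef_pV2 ?posrE ?exprn_gt0// ler_eXn2l ?ltr1n.
case: (ex_minnP ex) => n nd nmin; exists n; apply/andP; split; last first.
  by move: nd; rewrite exprS invfM ler_pdivrMl.
case: n nd nmin => [|n] nd nmin; first by rewrite expr0 invr1.
by rewrite ltNge; apply/negP => /nmin; rewrite ltnn.
Qed.

(** The strict inequality leaves room to enlarge a set of size [d] to an open one of size [2^-n];
    the error [e] pays for [d = 0], to which no dyadic scale is comparable. *)
Lemma dyadic_scale_pow d gamma e : 0 <= d < 1 -> 0 < gamma -> 0 < e ->
  exists n, d < 2 ^- n /\ (2 ^- n) `^ gamma <= 2 `^ gamma * d `^ gamma + e.
Proof.
move=> /andP[d0 d1] g0 e0.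
(* Sizes below [t] are replaced by [t], small enough that [(2 t)^gamma <= e]. *)
pose t := Num.min (e `^ gamma^-1 / 2) (1 / 2).
have t0 : 0 < t by rewrite lt_min !divr_gt0 ?powR_gt0.
have t1 : t < 1 by rewrite gt_min; apply/orP; right; lra.
have [|n /andP[dn nd]] := @dyadic_scale (Num.max d t).
  by rewrite lt_max t0 orbT gt_max d1 t1.
exists n; split; first by apply: le_lt_trans dn; rewrite le_max lexx.
apply: (@le_trans _ _ ((2 * Num.max d t) `^ gamma)).
  by rewrite ge0_ler_powR ?nnegrE ?(ltW g0)// ?invr_ge0 ?exprn_ge0// mulr_ge0// le_max d0.
have [dt|td] := leP d t.
  apply: (@le_trans _ _ e); last by rewrite lerDr mulr_ge0 ?powR_ge0.
  have -> : e = (e `^ gamma^-1) `^ gamma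
    by rewrite -powRrM mulVf ?gt_eqF// powRr1// ltW.
  rewrite ge0_ler_powR ?nnegrE ?(ltW g0) ?powR_ge0 ?mulr_ge0 ?(ltW t0)//.
  by rewrite -ler_pdivlMl// mulrC ge_min lexx.
by rewrite powRM// lerDl ltW.
Qed.

Definition pow2_ceil e : nat := (Num.truncn (2 `^ e)).+1.

Lemma pow2_ceil_ge e : 2 `^ e <= (pow2_ceil e)%:R.
Proof. exact/ltW/truncnS_gt. Qed.

(** The successor counts cells: [truncn (x * k)] takes [k + 1] values on [[0, 1]], the last one only
    at [x = 1]. *)
Lemma pow2_ceil_le e : 0 <= e -> (pow2_ceil e).+1%:R <= 3 * 2 `^ e.
Proof.
move=> e0; have h1 := powR2_ge1 e0.
rewrite /pow2_ceil -(addn2 (Num.truncn _)) natrD.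
have : (Num.truncn (2 `^ e))%:R <= 2 `^ e by rewrite truncn_le powR_ge0.
lra.
Qed.

Lemma truncn_eq_dist x y : 0 <= x -> 0 <= y -> Num.truncn x = Num.truncn y ->
  `|x - y| <= 1.
Proof.
move=> x0 y0 xy; have h1 := truncnS_gt x; have h2 := truncnS_gt y.
have h3 : (Num.truncn x)%:R <= x by rewrite truncn_le.
have h4 : (Num.truncn y)%:R <= y by rewrite truncn_le.
rewrite -natr1 -xy in h2; rewrite -natr1 in h1; rewrite -xy in h4.
by rewrite ler_norml; apply/andP; split; lra.
Qed.

Lemma truncn_unit_le x k : 0 <= x <= 1 -> (Num.truncn (x * k%:R) <= k)%N.
Proof.
move=> /andP[x0 x1]; rewrite -(ler_nat R); apply: le_trans (_ : x * k%:R <= _).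
  by rewrite truncn_le// mulr_ge0.
by rewrite ler_piMl.
Qed.

Lemma card_pow2_ceil N (e : 'I_N -> R) : (forall j, 0 <= e j) ->
  #|{: {dffun forall j : 'I_N, 'I_(pow2_ceil (e j)).+1}}|%:R
    <= 3 ^+ N * 2 `^ (\sum_j e j) :> R.
Proof.
move=> e0; rewrite card_dep_ffun foldrE big_map big_enum/= natr_prod.
rewrite powR2_sum -[X in _ ^+ X]card_ord -prodr_const -big_split/=.
by apply: ler_prod => j _; rewrite card_ord ler0n/= pow2_ceil_le.
Qed.

End powers_of_two.

(** * Gaussian variables *)

Section normal_law.
Variable R : realType.
Implicit Types m s x r : R.

Lemma normal_peak_le s : 0 < s -> normal_peak s <= s^-1.
Proof.
move=> s0; rewrite /normal_peak lef_pV2 ?posrE// ?sqrtr_gt0; last first.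
  by rewrite pmulrn_lgt0// mulr_gt0 ?exprn_gt0 ?pi_gt0.
rewrite -{1}(ger0_norm (ltW s0)) -sqrtr_sqr ler_wsqrtr//.
rewrite -mulrnAr ler_peMr ?sqr_ge0// -mulr_natr.
have := pi_ge2 R; lra.
Qed.

Lemma normal_peak_double s : 0 <= s -> normal_peak s = 2 * normal_peak (2 * s).
Proof.
move=> s0; rewrite /normal_peak.
have -> : (2 * s) ^+ 2 * pi *+ 2 = 2 ^+ 2 * (s ^+ 2 * pi *+ 2) by ring.
by rewrite sqrtrM ?sqr_ge0// sqrtr_sqr ger0_norm// invfM mulrA divff ?mul1r.
Qed.

(** Comparison with a density of total mass 1 and twice the deviation: the exponential factor alone
    then bounds the tail, and no Gaussian tail has to be integrated. *)
Lemma normal_pdf_double m s x : 0 < s ->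
  normal_pdf m s x =
  2 * expR (- (3 * (x - m) ^+ 2 / (8 * s ^+ 2))) * normal_pdf m (2 * s) x.
Proof.
move=> s0; rewrite !normal_pdfE ?gt_eqF ?mulr_gt0//= /normal_fun.
rewrite [normal_peak s]normal_peak_double ?ltW//.
rewrite mulrACA -expRD -!mulrA; congr (2 * (_ * expR _)).
by field; rewrite gt_eqF.
Qed.

(* [Num.max s `|m|] is comparable to the L^2 norm of the variable, so that the
   second moment alone controls the bound, whatever the mean. *)
Lemma normal_prob_small_ball m s r : 0 < s -> 0 <= r ->
  (normal_prob m s `[(- r)%R, r]%classic <= (4 * r / Num.max s `|m|)%:E)%E.
Proof.
move=> s0 r0.
have key (b : R) : 0 <= b -> (forall x, -r <= x <= r -> normal_pdf m s x <= b) ->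
    (normal_prob m s `[(- r)%R, r]%classic <= (2 * r * b)%:E)%E.
  move=> b0 hb.
  apply: (@le_trans _ _ (\int[lebesgue_measure]_(x in `[(- r)%R, r]%classic) b%:E)%E).
    apply: ge0_le_integral => //=.
    - by move=> x _; rewrite lee_fin normal_pdf_ge0.
    - by apply/measurable_EFinP/measurable_funTS; exact: measurable_normal_pdf.
  rewrite integral_cst//= lebesgue_measure_itv/= lte_fin.
  case: ltP => _; rewrite ?mule0 ?lee_fin ?mulr_ge0//.
  lra.
have H1 : normal_pdf m s = fun x => normal_peak s * normal_fun m s x.
  by rewrite normal_pdfE ?gt_eqF.
(* If the deviation dominates, the peak bounds the density. If [r >= |m| / 2], the bound exceeds 1.
   Otherwise [[-r, r]] stays at distance [|m| / 2] from the mean, and [expR e >= 1 + e] brings the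
   density below [2 / |m|]. *)
have [ms|sm] := leP `|m| s.
  apply: (le_trans (key (s^-1) _ _)).
  - by rewrite invr_ge0 ltW.
  - move=> x _; apply: le_trans (normal_peak_le s0).
    by apply: normal_pdf_ub; rewrite gt_eqF.
  - by rewrite lee_fin ler_wpM2r ?invr_ge0 ?(ltW s0)//; lra.
have m0 : 0 < `|m| by apply: lt_trans sm.
have [rm|mr] := leP (`|m| / 2) r.
  apply: le_trans (probability_le1 _ _) _ => //.
  rewrite lee_fin ler_pdivlMr//; lra.
apply: (le_trans (key (2 / `|m|) _ _)); last by rewrite lee_fin; lra.
  by rewrite divr_ge0// ltW.
move=> x /andP[rx xr]; rewrite H1 /normal_fun.
have xm : `|m| / 2 <= `|x - m|.
  have : `|x| <= r by rewrite ler_norml rx xr.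
  by have := ler_normB x (x - m); rewrite opprB addrCA subrr addr0; lra.
set e := (x - m) ^+ 2 / (s ^+ 2 *+ 2).
have e0 : 0 <= e by rewrite divr_ge0 ?sqr_ge0// mulrn_wge0 ?sqr_ge0.
have -> : - (x - m) ^+ 2 / (s ^+ 2 *+ 2) = - e by rewrite mulNr.
apply: (@le_trans _ _ (s^-1 * (1 + e)^-1)).
  rewrite ler_pM ?normal_peak_ge0 ?expR_ge0 ?normal_peak_le//.
  by rewrite expRN lef_pV2 ?posrE ?expR_gt0 ?ltr_wpDr// expR_ge1Dx.
rewrite -invfM ler_pdivlMr// mulrC ler_pdivrMr; last first.
  by rewrite mulr_gt0// ltr_wpDr.
have -> : 2 * (s * (1 + e)) = 2 * s + `|x - m| ^+ 2 / s.
  rewrite /e real_normK ?num_real//; field; lra.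
rewrite -(@ler_pM2r _ s)// mulrDl divfK ?gt_eqF//.
have : (`|m| / 2) ^+ 2 <= `|x - m| ^+ 2 by rewrite ler_sqr ?nnegrE ?divr_ge0.
nra.
Qed.

Lemma gt_norm_setC r : [set x : R | r < `|x|] = ~` `[(- r)%R, r]%classic.
Proof.
by apply/seteqP; split=> x /=; rewrite in_itv/= -ler_norml ltNge => /negP.
Qed.

Lemma measurable_gt_norm r : measurable [set x : R | r < `|x|].
Proof. by rewrite gt_norm_setC; exact: measurableC. Qed.

Lemma normal_prob_tail m s r : 0 < s -> 2 * `|m| <= r ->
  (normal_prob m s [set x : R | (r < `|x|)%R]%classic <=
   (2 * expR (- (r ^+ 2 / (16 * s ^+ 2))))%:E)%E.
Proof.
move=> s0 mr.
have mA : measurable [set x : R | r < `|x|].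
  exact: measurable_gt_norm.
have r0 : 0 <= r by apply: le_trans mr; rewrite mulr_ge0.
have s20 : 0 < 2 * s by rewrite mulr_gt0.
set c := 2 * expR _.
have c0 : 0 <= c by rewrite mulr_ge0 ?expR_ge0.
apply: (@le_trans _ _
   (\int[lebesgue_measure]_(x in [set x : R | (r < `|x|)%R]) (c%:E * (normal_pdf m (2 * s) x)%:E)))%E.
  apply: ge0_le_integral => //=.
  - by move=> x _; rewrite lee_fin normal_pdf_ge0.
  - by apply/measurable_EFinP/measurable_funTS; exact: measurable_normal_pdf.
  - apply/measurable_EFinP/measurable_funTS/measurable_funM => //.
    exact: measurable_normal_pdf.
  move=> x rx; rewrite lee_fin normal_pdf_double// ler_wpM2r ?normal_pdf_ge0//.
  rewrite ler_pM2l// ler_expR lerN2 ler_pdivlMr ?mulr_gt0 ?exprn_gt0//.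
  have : r ^+ 2 / 4 <= (x - m) ^+ 2.
    have -> : r ^+ 2 / 4 = (r / 2) ^+ 2 by field.
    rewrite -[leRHS]real_normK ?num_real// ler_sqr ?nnegrE ?divr_ge0//.
    by have := ler_normD (x - m) m; rewrite subrK; move: rx mr => /=; lra.
  have -> : r ^+ 2 / (16 * s ^+ 2) * (8 * s ^+ 2) = r ^+ 2 / 2 by field; lra.
  by have := sqr_ge0 r; lra.
rewrite ge0_integralZl//=.
- rewrite -[leRHS]mule1 lee_wpmul2l ?lee_fin//.
  exact: (@probability_le1 _ _ _ (normal_prob m (2 * s))).
- by apply/measurable_EFinP/measurable_funTS; exact: measurable_normal_pdf.
- by move=> x _; rewrite lee_fin normal_pdf_ge0.
Qed.
End normal_law.

(** * Small balls and tails of Gaussian variables in terms of the second moment *)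

Section gaussian_variable.
Context (R : realType).
Implicit Types m s r v M : R.

Lemma gaussian_law_small_ball m s r : 0 <= s -> 0 < Num.max s `|m| -> 0 <= r ->
  (gaussian_law m s `[(- r)%R, r]%classic <= (4 * r / Num.max s `|m|)%:E)%E.
Proof.
move=> s0 M0 r0; rewrite /gaussian_law; have [s00|sn0] := eqVneq s 0; last first.
  by apply: normal_prob_small_ball => //; rewrite lt0r sn0.
rewrite s00 in M0 *; have mM : Num.max 0 `|m| = `|m| by rewrite max_r.
rewrite mM in M0 *; rewrite diracE lee_fin.
have [|_] := boolP (_ \in _); last by rewrite divr_ge0 ?mulr_ge0.
rewrite inE/= in_itv/= -ler_norml => mr; rewrite ler_pdivlMr//; lra.
Qed.

Lemma gaussian_law_tail m s M r : 0 <= s <= M -> `|m| <= M -> 0 < M ->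
  2 * M <= r ->
  (gaussian_law m s [set x : R | (r < `|x|)%R]%classic <=
    (2 * expR (- (r ^+ 2 / (16 * M ^+ 2))))%:E)%E.
Proof.
move=> /andP[s0 sM] mM M0 rM.
rewrite /gaussian_law; have [s00|sn0] := eqVneq s 0.
  rewrite diracE memNset ?lee_fin ?mulr_ge0 ?expR_ge0//= => rm; lra.
have {}s0 : 0 < s by rewrite lt0r sn0.
apply: le_trans (normal_prob_tail _ _) _ => //; first lra.
rewrite lee_fin ler_pM2l// ler_expR lerN2 ler_wpM2l ?sqr_ge0//.
rewrite lef_pV2 ?posrE ?mulr_gt0 ?exprn_gt0// ler_pM2l//.
by rewrite ler_sqr ?nnegrE// ltW.
Qed.

Context d (T : measurableType d) (P : probability T R).
Implicit Types Y : {RV P >-> R}.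

Lemma measurable_preimage Y B : measurable B -> measurable (Y @^-1` B).
Proof.
by move=> mB; rewrite -[X in measurable X]setTI; exact: measurable_funP.
Qed.

(** Layer-cake formula: the probability that [Y^2 > r] is at most 1 up to [4 M^2] and at most
    [2 exp(-r / (16 M^2))] beyond. The two ranges contribute [4 M^2] and [2 * 16 M^2]. *)
Lemma second_moment_gaussian Y m s M : 0 <= s <= M -> `|m| <= M -> 0 < M ->
  (forall B : set R, measurable B -> P (Y @^-1` B) = gaussian_law m s B) ->
  ('E_P[fun w => (Y w ^+ 2)%R] <= (36 * M ^+ 2)%:E)%E.
Proof.
move=> sM mM M0 lawY.
have -> : (fun w => Y w ^+ 2) = (Y ^+ 2)%R :> (T -> R) by [].
rewrite ge0_expectation_ccdf; last by move=> x /=; exact: sqr_ge0.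
pose rate := (16 * M ^+ 2)^-1.
have rate0 : 0 < rate by rewrite invr_gt0 mulr_gt0// exprn_gt0.
pose f1 r := (\1_(`[0%R, 4 * M ^+ 2]%classic) r : R).
(* The exponential tail is a multiple of an exponential density, whose integral is 1. *)
pose f2 r := exponential_pdf rate r.
have [c cE] : exists c, c = 2 / rate by exists (2 / rate).
have c0 : 0 <= c by rewrite cE divr_ge0// ltW.
have mf1 : measurable_fun setT f1 by exact: measurable_indic.
have mf2 : measurable_fun setT f2 by exact: measurable_exponential_pdf.
have f20 r : 0 <= f2 r by exact/exponential_pdf_ge0/ltW.
apply: (@le_trans _ _ (\int[lebesgue_measure]_(r in `[0%R, +oo[%classic)
   ((f1 r)%:E + c%:E * (f2 r)%:E))%E).
  apply: ge0_le_integral => //=.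
  - by apply: measurable_funTS; exact: ccdf_measurable.
  - apply: emeasurable_funD.
      by apply/measurable_EFinP/measurable_funTS.
    by apply: emeasurable_funM => //; apply/measurable_EFinP/measurable_funTS.
  move=> r; rewrite in_itv/= andbT => r0.
  rewrite /f1 indicE; have [|] := boolP (r \in _).
    move=> _; apply: le_trans (probability_le1 _ (measurable_itv _)) _.
    by rewrite leeDl// mule_ge0 ?lee_fin.
  move=> /negP; rewrite inE/= in_itv/= r0/= => /negP; rewrite -ltNge => Mr.
  rewrite add0e /f2 exponential_pdfE// /ccdf /distribution /pushforward/=.
  have -> : (fun w => Y w ^+ 2) @^-1` `]r, +oo[ =
     Y @^-1` [set x : R | (Num.sqrt r < `|x|)%R].
    apply/seteqP; split => w /=; rewrite in_itv/= andbT -sqrtr_sqr.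
      by move=> h; rewrite ltr_sqrt// (le_lt_trans r0 h).
    by move=> h; rewrite ltNge; apply/negP => /ler_wsqrtr; rewrite leNgt h.
  rewrite lawY; last exact: measurable_gt_norm.
  apply: le_trans (gaussian_law_tail sM mM M0 _) _.
    have M20 : 0 <= 2 * M by rewrite mulr_ge0// ltW.
    rewrite -(ger0_norm M20) -sqrtr_sqr; apply: ler_wsqrtr.
    by have -> : (2 * M) ^+ 2 = 4 * M ^+ 2; [ring|exact: ltW].
  rewrite -EFinM lee_fin (mulrA c) cE divfK ?gt_eqF// sqr_sqrtr// ler_pM2l//.
  by rewrite /rate mulNr mulrC.
have mE (f : R -> R) D : measurable_fun setT f ->
    measurable_fun D (fun x => (f x)%:E).
  by move=> mf; apply/measurable_EFinP/measurable_funTS.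
rewrite ge0_integralD//=; first last.
- by apply: emeasurable_funM => //; exact: mE.
- by move=> r _; rewrite mule_ge0 ?lee_fin.
- exact: mE.
- by move=> r _; rewrite lee_fin.
rewrite integral_indic//= ge0_integralZl//=; first last.
- by move=> r _; rewrite lee_fin.
- exact: mE.
have -> : 36 * M ^+ 2 = 4 * M ^+ 2 + c * 1 by rewrite cE /rate invrK; ring.
rewrite EFinD EFinM; apply: leeD.
  apply: (@le_trans _ _ (lebesgue_measure `[0%R, (4 * M ^+ 2)%R]%classic)).
    by apply: le_measure; rewrite ?inE//; apply: measurableI.
  rewrite lebesgue_measure_itv/= lte_fin; case: ifPn => _;
    rewrite ?lee_fin ?subr0//.
  by rewrite mulr_ge0 ?sqr_ge0.
rewrite (EFinM c) lee_wpmul2l ?lee_fin// -(integral_exponential_pdf rate0).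
apply: ge0_subset_integral => //=; first exact: mE.
by move=> r _; rewrite lee_fin.
Qed.

(** The second moment is at most [36 M^2], with [M] the larger of the deviation and the absolute
    mean; hence [M >= sqrt v / 6]. *)
Lemma gaussian_small_ball Y v r : is_gaussian P Y -> 0 < v ->
  (v%:E <= 'E_P[fun w => (Y w ^+ 2)%R])%E -> 0 <= r ->
  (P (Y @^-1` `[(- r)%R, r]%classic) <= (24 * r / Num.sqrt v)%:E)%E.
Proof.
move=> [m [s [s0 lawY]]] v0 vY r0; set M := Num.max s `|m|.
have vM e : M <= e -> 0 < e -> v <= 36 * e ^+ 2.
  rewrite /M ge_max => /andP[se me] e0; rewrite -lee_fin; apply: le_trans vY _.
  by apply: second_moment_gaussian lawY; rewrite ?s0.
(* If [M] vanished, the moment bound would hold for every [e > 0]; at [e = sqrt v / 12] it reads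
   [v <= v / 4]. *)
have M0 : 0 < M.
  rewrite ltNge; apply/negP => M0.
  have e0 : 0 < Num.sqrt v / 12 by rewrite divr_gt0 ?sqrtr_gt0.
  have := vM _ (le_trans M0 (ltW e0)) e0.
  have -> : (Num.sqrt v / 12) ^+ 2 = v / 144
    by rewrite expr_div_n sqr_sqrtr ?ltW//; field.
  lra.
rewrite lawY; last exact: measurable_itv.
apply: le_trans (gaussian_law_small_ball _ _ _) _ => //.
rewrite lee_fin -/M ler_pdivrMr// mulrAC ler_pdivlMr ?sqrtr_gt0//.
have : Num.sqrt v <= 6 * M.
  have M60 : 0 <= 6 * M by rewrite mulr_ge0// ltW.
  rewrite -(ger0_norm M60) -sqrtr_sqr; apply: ler_wsqrtr.
  by have -> : (6 * M) ^+ 2 = 36 * M ^+ 2; [ring|exact: vM].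
move=> h; have := ler_wpM2l r0 h; lra.
Qed.

Lemma gaussian_tail_exp Y v r : is_gaussian P Y -> 0 < v ->
  ('E_P[fun w => (Y w ^+ 2)%R] <= v%:E)%E -> 22 * Num.sqrt v <= r ->
  (P (Y @^-1` [set x : R | (r < `|x|)%R]%classic) <=
    (2 * expR (- (r ^+ 2 / (44 ^+ 2 * v))))%:E)%E.
Proof.
move=> [m [s [s0 lawY]]] v0 vY vr; set M := Num.max s `|m|.
have sv0 : 0 < Num.sqrt v by rewrite sqrtr_gt0.
(* Chebyshev's inequality puts mass at least [3 / 4] on the ball of radius [2 sqrt v], and the small
   ball bound puts at most [8 sqrt v / M] there. Hence [M <= (32 / 3) sqrt v]; the constants 22 and
   44 are [2 * 11] and [4 * 11]. *)
have M11 : M <= 11 * Num.sqrt v.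
  have [|M0] := leP M 0; first by move=> /le_trans -> //; rewrite mulr_ge0// ltW.
  set r2 := 2 * Num.sqrt v; have r20 : 0 < r2 by rewrite mulr_gt0.
  have cheb : ((4 * v)%:E * P (Y @^-1` [set x : R | (r2 < `|x|)%R]%classic) <= v%:E)%E.
    have -> : 4 * v = r2 ^+ 2 by rewrite exprMn sqr_sqrtr ?ltW//; ring.
    apply: (@le_trans _ _ ((r2 ^+ 2)%:E * P [set w | (r2%:E <= `|(Y w)%:E|)%E])%E).
      rewrite lee_wpmul2l ?lee_fin ?sqr_ge0//; apply: le_measure; rewrite ?inE.
      - by apply: measurable_preimage; exact: measurable_gt_norm.
      - rewrite (_ : [set w | _] = Y @^-1` (~` `](- r2)%R, r2[%classic)).
          by apply: measurable_preimage; exact: measurableC.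
        apply/seteqP; split=> w /=; rewrite lee_fin in_itv/= -ltr_norml leNgt.
          by move/negP.
        by move=> /negP.
      - by move=> w /= /ltW.
    apply: (le_trans (@markov _ _ _ P Y (fun x => x ^+ 2) r2 _ _ _ _)) => //.
    - by move=> r' _; exact: sqr_ge0.
    - by move=> x y; rewrite !nnegrE => x0 y0; rewrite ler_sqr.
    apply: le_trans vY; rewrite le_eqVlt; apply/orP; left; apply/eqP.
    by congr ('E_P[ _ ])%E; apply/funext => w /=; rewrite real_normK ?num_real.
  have : (P (Y @^-1` `[(- r2)%R, r2]%classic) <= (4 * r2 / M)%:E)%E.
    rewrite lawY; last exact: measurable_itv.
    by apply: gaussian_law_small_ball => //; rewrite ltW.
  have mA : measurable (Y @^-1` `[(- r2)%R, r2]%classic).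
    by apply: measurable_preimage; exact: measurable_itv.
  move: cheb; rewrite gt_norm_setC preimage_setC probability_setC//.
  rewrite -(fineK (fin_num_measure P _ mA)); move: (fine _) => q.
  rewrite -EFinB -EFinM !lee_fin ler_pdivlMr// => q1 q2.
  have q34 : 3 / 4 <= q by rewrite -(ler_pM2l v0); lra.
  have := ler_wpM2r (ltW M0) q34; rewrite /r2 in q2; lra.
rewrite lawY; last exact: measurable_gt_norm.
have -> : 44 ^+ 2 * v = 16 * (11 * Num.sqrt v) ^+ 2.
  by rewrite exprMn sqr_sqrtr ?ltW//; ring.
move: M11; rewrite /M ge_max => /andP[sM mM].
apply: gaussian_law_tail; rewrite ?s0 ?mulr_gt0//; lra.
Qed.

(** This is [expR y >= y] at [y = x / q.+1], raised to the power [q.+1] and inverted. *)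
Lemma expRN_le_pow (q : nat) (x : R) : 0 < x ->
  expR (- x) <= (q.+1%:R / x) ^+ q.+1.
Proof.
move=> x0; rewrite expRN -[leRHS]invrK lef_pV2 ?posrE ?expR_gt0//; last first.
  by rewrite invr_gt0 exprn_gt0// divr_gt0.
rewrite -exprVn invf_div.
have {2}-> : x = x / q.+1%:R *+ q.+1 by rewrite -mulr_natr divfK.
rewrite -[X in expR X]mulr_natl expRM_natl.
apply: lerXn2r; rewrite ?nnegrE ?expR_ge0 ?divr_ge0 ?ltW//.
by apply: lt_le_trans (expR_ge1Dx _); rewrite ltrDr.
Qed.

(** A power of [v / r^2] of arbitrarily high order will beat the number of pairs of nodes in the
    chaining. Where the exponential bound does not apply, the right-hand side exceeds 1. *)
Lemma gaussian_tail (q : nat) Y v r : is_gaussian P Y -> 0 < v ->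
  ('E_P[fun w => (Y w ^+ 2)%R] <= v%:E)%E -> 0 < r ->
  (P (Y @^-1` [set x : R | (r < `|x|)%R]%classic) <=
    (2 * (44 ^+ 2 * q.+1%:R * v / r ^+ 2) ^+ q.+1)%:E)%E.
Proof.
move=> gY v0 vY r0.
have [rv|vr] := ltP r (22 * Num.sqrt v).
  apply: le_trans (probability_le1 _ _) _.
    by apply: measurable_preimage; exact: measurable_gt_norm.
  rewrite lee_fin; have : 1 <= (44 ^+ 2 * q.+1%:R * v / r ^+ 2) ^+ q.+1.
    rewrite exprn_ege1// ler_pdivlMr ?exprn_gt0// mul1r.
    have : r ^+ 2 <= (22 * Num.sqrt v) ^+ 2.
      by rewrite ler_sqr ?nnegrE ?mulr_ge0 ?sqrtr_ge0 ?(ltW r0)// ltW.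
    rewrite exprMn sqr_sqrtr ?(ltW v0)// => /le_trans; apply.
    rewrite ler_wpM2r ?(ltW v0)//.
    have q1 : 1 <= q.+1%:R :> R by rewrite ler1n.
    apply: (@le_trans _ _ (44 ^+ 2 * 1)); first lra.
    by rewrite ler_wpM2l ?exprn_ge0.
  lra.
apply: le_trans (gaussian_tail_exp gY v0 vY vr) _.
rewrite lee_fin ler_pM2l//.
apply: le_trans (expRN_le_pow q _) _; first
  by rewrite divr_gt0 ?mulr_gt0 ?exprn_gt0.
by rewrite invf_div mulrA [_ * (44 ^+ 2 * v)]mulrA (mulrC _ (44 ^+ 2)).
Qed.
End gaussian_variable.

(** * Hausdorff dimension *)

Section hausdorff.
Variable R : realType.
Implicit Types (n : nat) (s r e : R).

Lemma diam_pow_ge0 n s (U : set 'rV[R]_n) : (0 <= diam_pow s U)%E.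
Proof. by rewrite /diam_pow; case: ifP => _ //; exact: poweR_ge0. Qed.

Lemma diam_ge0 n (U : set 'rV[R]_n) : U !=set0 -> (0 <= diam U)%E.
Proof.
move=> [x Ux]; apply: le_trans (ereal_sup_ubound _); last by exists x => //;
  exists x.
by rewrite lee_fin sqrtr_ge0.
Qed.

Lemma diam_pow_le n s r (U : set 'rV[R]_n) : 0 <= s -> 0 <= r ->
  (diam U <= r%:E)%E -> (diam_pow s U <= (r `^ s)%:E)%E.
Proof.
move=> s0 r0 Ur; rewrite /diam_pow; case: ifP => [_|/negbT /asboolPn U0].
  by rewrite lee_fin powR_ge0.
rewrite -poweR_EFin.
apply: gt0_ler_poweR => //; rewrite ?in_itv/= ?andbT ?leey ?lee_fin ?r0//.
by rewrite diam_ge0//; exact/set0P/eqP.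
Qed.

Lemma nneseries_le_bound (f : nat -> \bar R) (x : \bar R) :
  (forall i, 0 <= f i)%E -> (forall k, \sum_(0 <= i < k) f i <= x)%E ->
  (\sum_(0 <= i <oo) f i <= x)%E.
Proof.
move=> f0 fx; apply: lime_le; first exact: is_cvg_nneseries.
exact: nearW.
Qed.

Lemma hausdorff_premeasure_ge0 n s e (A : set 'rV[R]_n) :
  (0 <= hausdorff_premeasure s e A)%E.
Proof.
apply/ereal_infP => _ [U _ <-]; apply: nneseries_ge0 => i _ _.
exact: diam_pow_ge0.
Qed.

Lemma hausdorff_premeasure_le_finite n s r e (A : set 'rV[R]_n) (K : finType)
    (V : K -> set 'rV[R]_n) : 0 <= s -> 0 <= r <= e ->
  A `<=` [set x | exists k, V k x] -> (forall k, (diam (V k) <= r%:E)%E) ->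
  (hausdorff_premeasure s e A <= (#|K|%:R * r `^ s)%:E)%E.
Proof.
move=> s0 /andP[r0 re] AV Vr.
(* The finite cover is padded with empty sets, which [diam_pow] counts for 0 even when [s = 0]. *)
pose U i := if (insub i : option 'I_#|K|) is Some j then V (enum_val j) else set0.
have Ur i : (diam (U i) <= r%:E)%E.
  rewrite /U; case: insubP => [j _ _|_]; first exact: Vr.
  by apply/ereal_supP => x [? []].
apply: (@le_trans _ _ (\sum_(0 <= i <oo) diam_pow s (U i))%E).
  apply: ereal_inf_lbound; exists U => //; split.
    move=> x /AV[k Vkx]; exists (enum_rank k) => //.
    by rewrite /U insubT // => lti;
      rewrite (_ : Sub _ _ = enum_rank k) ?enum_rankK //; exact: val_inj.
  by move=> i; apply: le_trans (Ur i) _; rewrite lee_fin.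
apply: nneseries_le_bound => [i|k]; first exact: diam_pow_ge0.
apply: (@le_trans _ _ (\sum_(0 <= i < k) (if (i < #|K|)%N then (r `^ s)%:E else 0))%E).
  apply: lee_sum => i _; case: ifP => iK; first exact: diam_pow_le.
  rewrite /U insubF // /diam_pow.
  by case: ifP => // /negbT /asboolPn.
apply: (@le_trans _ _ ((minn k #|K|)%:R * r `^ s)%:E); last first.
  by rewrite lee_fin ler_wpM2r ?powR_ge0// ler_nat geq_minr.
elim: k => [|k IH]; first by rewrite big_geq// min0n mul0r.
rewrite big_nat_recr//=; case: ltnP => kK.
  rewrite (minn_idPl kK) -natr1 mulrDl mul1r EFinD leeD2r//.
  by rewrite (minn_idPl (ltnW kK)) in IH.
by rewrite adde0 (minn_idPr (leqW kK)); rewrite (minn_idPr kK) in IH.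
Qed.

Lemma hausdorff_dim_le n s (A : set 'rV[R]_n) : 0 <= s ->
  (forall e, 0 < e -> exists (K : finType) (V : K -> set 'rV[R]_n) (r : R),
     [/\ A `<=` [set x | exists k, V k x], 0 <= r <= e,
      forall k, (diam (V k) <= r%:E)%E & #|K|%:R * r `^ s <= e]) ->
  (hausdorff_dim A <= s%:E)%E.
Proof.
move=> s0 cover; apply: ereal_inf_lbound; exists s => //; split => //.
apply/eqP; rewrite eq_le; apply/andP; split.
  apply/ereal_supP => _ [e /= e0 <-].
  apply/lee_addgt0Pr => e' e'0; rewrite add0e.
  have [|K [V [r [AV /andP[r0 re] Vr Kr]]]] := cover (Num.min e e').
    by rewrite lt_min e0.
  rewrite !le_min in re Kr; case/andP: re => re _; case/andP: Kr => _ Kr.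
  apply: le_trans (hausdorff_premeasure_le_finite s0 _ AV Vr) _.
    by rewrite r0.
  by rewrite lee_fin.
apply: le_trans (ereal_sup_ubound _); last by exists 1 => //=.
exact: hausdorff_premeasure_ge0.
Qed.

End hausdorff.

(** * Lower bounds on the dimension from discrete energies *)

Section mass_distribution.
Variable R : realType.
Implicit Types (q n k m : nat) (s r e c d gamma : R).

Lemma coord_le_euclid q (x y : 'rV[R]_q) (i : 'I_q) :
  `|x 0 i - y 0 i| <= euclid_dist x y.
Proof.
rewrite /euclid_dist -sqrtr_sqr; apply: ler_wsqrtr.
by rewrite (bigD1 i)//= lerDl sumr_ge0// => j _; exact: sqr_ge0.
Qed.

(** Makes the sets of a cover open, so that compactness extracts a finite subcover. *)
Lemma thicken q (U : set 'rV[R]_q) d e : d < e ->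
  (forall x y, U x -> U y -> forall i, `|x 0 i - y 0 i| <= d) ->
  exists V, [/\ open V, U `<=` V &
    forall x y, V x -> V y -> forall i, `|x 0 i - y 0 i| <= e].
Proof.
move=> de Ud; have e0 : 0 < (e - d) / 2 by rewrite divr_gt0// subr_gt0.
exists (\bigcup_(x in U) ball x ((e - d) / 2)); split.
- by apply: bigcup_open => x _; exact: ball_open.
- by move=> x Ux; exists x => //; exact: ballxx.
move=> x y [x' Ux' bx] [y' Uy' by'] i.
have := bx.2 0 i; have := by'.2 0 i; rewrite /ball/= => h1 h2.
have h := Ud _ _ Ux' Uy' i.
have -> : x 0 i - y 0 i = - (x' 0 i - x 0 i) + (x' 0 i - y' 0 i) + (y' 0 i - y 0 i).
  by ring.
apply: le_trans (ler_normD _ _) _;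
  apply: le_trans (lerD (ler_normD _ _) (lexx _)) _.
rewrite normrN; lra.
Qed.

(* AM-GM [1 <= (l a / w + w / (l a)) / 2] with [l = 1 / (M #|I|)], summed over
   the classes of [f], of cardinal [a]. *)
Lemma energy_classes (I : finType) k (f : I -> 'I_k) (w : 'I_k -> R) (M : R) :
  (0 < #|I|)%N -> (forall j, 0 < w j) -> 0 < M ->
  \sum_i \sum_i' (f i == f i')%:R / w (f i) <= M * #|I|%:R ^+ 2 ->
  1 <= M * \sum_j w j.
Proof.
move=> I0 w0 M0 HM; set n := #|I|%:R : R.
have n0 : 0 < n by rewrite ltr0n.
pose a j : R := \sum_i (f i == j)%:R.
have sa : \sum_j a j = n.
  rewrite exchange_big/= /n -sum1_card natr_sum; apply: eq_bigr => i _.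
  rewrite (bigD1 (f i))//= eqxx big1 ?addr0// => j jf.
  by rewrite eq_sym (negbTE jf).
have sa2 : \sum_j a j ^+ 2 / w j <= M * n ^+ 2.
  apply: le_trans HM; rewrite le_eqVlt; apply/orP; left; apply/eqP.
  transitivity (\sum_j \sum_i \sum_i' (f i == j)%:R * (f i' == j)%:R / w j).
    apply: eq_bigr => j _; rewrite expr2 /a mulr_suml mulr_suml.
    apply: eq_bigr => i _; rewrite mulr_sumr mulr_suml; exact: eq_bigr.
  rewrite exchange_big/=; apply: eq_bigr => i _.
  rewrite exchange_big/=; apply: eq_bigr => i' _.
  rewrite (bigD1 (f i))//= eqxx mul1r big1 ?addr0 1?eq_sym// => j jf.
  by rewrite eq_sym (negbTE jf) !mul0r.
have amgm j : a j <= (a j ^+ 2 / w j / (M * n) + w j * (M * n)) / 2.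
  have := w0 j; set u := w j => u0; set b := a j; set l := M * n.
  have l0 : 0 < l by rewrite mulr_gt0.
  have -> : b ^+ 2 / u / l + u * l = (b ^+ 2 + (u * l) ^+ 2) / (u * l).
    by field; rewrite !gt_eqF.
  have ul0 : 0 < u * l by rewrite mulr_gt0.
  rewrite ler_pdivlMr// ler_pdivlMr//; have := sqr_ge0 (b - u * l); nra.
have : n <= (M * n ^+ 2 / (M * n) + (\sum_j w j) * (M * n)) / 2.
  rewrite -{1}sa; apply: le_trans (ler_sum _ (fun j _ => amgm j)) _.
  rewrite -mulr_suml ler_pM2r ?invr_gt0// big_split/= -!mulr_suml lerD2r.
  by rewrite ler_pM2r// invr_gt0 mulr_gt0.
have -> : M * n ^+ 2 / (M * n) = n by field; rewrite !gt_eqF.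
move=> h; rewrite -(ler_pM2r n0); nra.
Qed.

(* The sum over [n] is a discrete [gamma]-energy of the points [x i]. Only scales
   down to [2^-m] enter: by compactness a cover can be taken finite, and [m]
   beyond all its scales. *)
Lemma hausdorff_dim_ge q (A : set 'rV[R]_q) gamma (M : R) : compact A ->
  0 < gamma -> 0 < M ->
  (forall n0, exists m (I : finType) (x : I -> 'rV[R]_q), [/\ (n0 <= m)%N,
     (0 < #|I|)%N, forall i, A (x i) &
     \sum_(n < m.+1) \sum_i \sum_i'
        (`[< forall l, `|x i 0 l - x i' 0 l| <= 2 ^- n >])%:R / (2 ^- n) `^ gamma
       <= M * #|I|%:R ^+ 2]) ->
  (gamma%:E <= hausdorff_dim A)%E.
Proof.
move=> cA g0 M0 energy; apply/ereal_infP => _ [s [s0 HsA] <-].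
rewrite lee_fin leNgt; apply/negP => sg.
(* With this [c] the final bound [M * (2^gamma c + c)] equals [1 / 2], against the lower bound 1. *)
pose c := (2 * (M * (2 `^ gamma + 1)))^-1.
have c0 : 0 < c by rewrite invr_gt0 !mulr_gt0// ltr_wpDl ?powR_ge0.
(* A mesh below 1 gives [d i < 1]: then [(d i)^gamma <= (d i)^s] as [s < gamma], and
   [dyadic_scale_pow] applies. *)
have : (hausdorff_premeasure s 4^-1 A < c%:E)%E.
  apply: (@le_lt_trans _ _ 0%E); rewrite ?lte_fin// -HsA.
  by apply: ereal_sup_ubound; exists 4^-1 => //=; rewrite invr_gt0.
move=> /ereal_inf_lt[_ [U [AU Ud] <-] Uc].
(* The diameter of the empty set is [-oo]; 0 stands for it. *)
pose d i := if `[< U i = set0 >] then 0 else fine (diam (U i)).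
have dE i : ~ U i = set0 -> diam (U i) = (d i)%:E.
  move=> Ui0; rewrite /d asboolF// fineK// fin_numElt.
  rewrite (lt_le_trans _ (diam_ge0 _)) ?ltNye//; last exact/set0P/eqP.
  by rewrite (le_lt_trans (Ud i))// ltry.
have d01 i : 0 <= d i < 1.
  have [U0|U0] := pselect (U i = set0); first by rewrite /d asboolT// lexx ltr01.
  have := Ud i; rewrite (dE _ U0) lee_fin => h; apply/andP; split; last by lra.
  by rewrite -lee_fin -(dE _ U0) diam_ge0//; exact/set0P/eqP.
have dU i x y : U i x -> U i y -> forall l, `|x 0 l - y 0 l| <= d i.
  move=> Ux Uy l; apply: le_trans (coord_le_euclid _ _ _) _.
  have U0 : ~ U i = set0 by move=> U0; rewrite U0 in Ux.
  rewrite -lee_fin -(dE _ U0); apply: ereal_sup_ubound.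
  by exists x => //; exists y.
have dpow i : ((d i `^ gamma)%:E <= diam_pow s (U i))%E.
  have [U0|U0] := pselect (U i = set0).
    rewrite /d asboolT// powR0 ?gt_eqF//; exact: diam_pow_ge0.
  rewrite /diam_pow asboolF// dE// -poweR_EFin lee_fin.
  have /andP[di0 di1] := d01 i.
  have [->|di] := eqVneq (d i) 0; first by rewrite powR0 ?gt_eqF// powR_ge0.
  by rewrite ger_powR// ?ltW// lt0r di di0.
pose e i := c * 2 ^- i.+1.
have e0 i : 0 < e i by rewrite mulr_gt0// invr_gt0 exprn_gt0.
have [nn nnP] := choice (fun i => dyadic_scale_pow (d01 i) g0 (e0 i)).
have [V VP] := choice (fun i => thicken (nnP i).1 (dU i)).
have : A `<=` \bigcup_(i in [set: nat]) V i.
  by move=> x /AU[i _ Uix]; exists i => //; case: (VP i) => _ UV _; exact: UV.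
move: cA; rewrite compact_cover => cA /(cA _ setT V)[].
  by move=> i _; case: (VP i).
move=> D _ AD.
pose k := (\max_(i <- finmap.enum_fset D) i).+1.
have AV x : A x -> exists j : 'I_k, V j x.
  move=> /AD[i iD Vix]; have ik : (i < k)%N.
    by rewrite /k ltnS; apply: (@leq_bigmax_seq _ _ xpredT id).
  by exists (Ordinal ik).
have [m [I [x [mge I0 Ax mE]]]] := energy (\max_(j < k) nn j).
(* Each point is assigned to one open set containing it. Two points of one class [j] are then within
   [2^-(nn j)] in every coordinate, so the energy at the scale [nn j <= m] counts this pair. *)
have [f fP] := choice (fun i => AV _ (Ax i)).
pose w (j : 'I_k) := (2 ^- nn j) `^ gamma : R.
have w0 j : 0 < w j by rewrite powR_gt0// invr_gt0 exprn_gt0.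
have := energy_classes I0 w0 M0 (f := f).
have -> : \sum_i \sum_i' (f i == f i')%:R / w (f i) <= M * #|I|%:R ^+ 2.
  apply: le_trans mE; rewrite [leRHS]exchange_big/=; apply: ler_sum => i _.
  rewrite [leRHS]exchange_big/=; apply: ler_sum => i' _.
  have nm : (nn (f i) < m.+1)%N.
    by rewrite ltnS (leq_trans _ mge)//; exact: (leq_bigmax (f i)).
  rewrite (bigD1 (Ordinal nm))//= -[leLHS]addr0; apply: lerD; last first.
    by apply: sumr_ge0 => n _; rewrite divr_ge0 ?powR_ge0.
  rewrite ler_wpM2r ?invr_ge0 ?powR_ge0// ler_nat.
  have [ff|//] := eqVneq (f i) (f i').
  rewrite asboolT//; case: (VP (f i)) => _ _; apply; first exact: fP.
  by rewrite ff; exact: fP.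
move=> /(_ isT).
have wle : \sum_j w j <= 2 `^ gamma * c + c.
  apply: (@le_trans _ _ (2 `^ gamma * \sum_(j < k) d j `^ gamma + \sum_(j < k) e j)).
    rewrite mulr_sumr -big_split/=; apply: ler_sum => j _; exact: (nnP j).2.
  apply: lerD.
    rewrite ler_wpM2l ?powR_ge0// -lee_fin; apply: le_trans (ltW Uc).
    apply: (@le_trans _ _ (\sum_(0 <= j < k) diam_pow s (U j))%E).
      by rewrite -sumEFin big_mkord; apply: lee_sum => j _; exact: dpow.
    by apply: nneseries_lim_ge => i _ _; exact: diam_pow_ge0.
  by rewrite -mulr_sumr ler_piMr ?(ltW c0)// sum_half_powers.
move=> h; have : 1 <= M * (2 `^ gamma * c + c).
  by apply: le_trans h _; rewrite ler_wpM2l// ltW.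
have -> : M * (2 `^ gamma * c + c) = 1 / 2.
  rewrite /c; field; rewrite !gt_eqF// ?ltr_wpDl ?powR_ge0//.
lra.
Qed.

End mass_distribution.

Lemma euclid_dist_le_coord (R : realType) N (s t : 'rV[R]_N) (a : R) : 0 <= a ->
  (forall j, `|s 0 j - t 0 j| <= a) -> euclid_dist s t <= N.+1%:R * a.
Proof.
move=> a0 sta; have Na : 0 <= N.+1%:R * a by rewrite mulr_ge0.
rewrite -(ger0_norm Na) -sqrtr_sqr; apply: ler_wsqrtr.
apply: (@le_trans _ _ (\sum_(j < N) a ^+ 2)).
  apply: ler_sum => j _; rewrite -[leLHS]real_normK ?num_real//.
  by rewrite ler_sqr ?nnegrE.
rewrite sumr_const card_ord -[leLHS]mulr_natl exprMn ler_wpM2r ?sqr_ge0//.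
by rewrite -natrX ler_nat expnS expn1 (leq_trans (leqnSn _))// leq_pmulr.
Qed.

Lemma compact_unit_cube (R : realType) N : compact (@unit_cube R N).
Proof.
have := @rV_compact R N (fun=> `[0, 1]%classic) (fun=> @segment_compact R 0 1).
by congr compact; apply/seteqP; split => t h j; have := h j; rewrite /= in_itv.
Qed.

Lemma continuous_row (R : realType) (T : topologicalType) n (f : T -> 'rV[R]_n) :
  (forall i, continuous (fun t => f t 0 i)) -> continuous f.
Proof.
move=> cf t; apply/cvg_ballP => e e0.
have fe i : \forall u \near t, ball (f t 0 i) e (f u 0 i).
  by move: (cf i t) => /cvg_ballP; apply.
apply: filterS (filter_forall _ fe).
by move=> u fu; split=> // i j; rewrite ord1; exact: fu.
Qed.

(** * Finite unions and sums over a probability space *)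

(** By Fatou's lemma the lower limit of [f m] is integrable, hence almost surely finite, and any
    larger number bounds [f m] for infinitely many [m]. *)
Lemma ae_bounded_often d (T : measurableType d) (R : realType)
    (P : {measure set T -> \bar R}) (f : nat -> T -> \bar R) (C : R) :
  (forall m, measurable_fun setT (f m)) -> (forall m w, (0 <= f m w)%E) ->
  (forall m, (\int[P]_w f m w <= C%:E)%E) ->
  {ae P, forall w, exists M : R, 0 < M /\
    forall n0, exists m, (n0 <= m)%N /\ (f m w <= M%:E)%E}.
Proof.
move=> mf f0 fC; pose g w := limn_einf (f^~ w).
have mg : measurable_fun setT g by apply: measurableT_comp => //;
  apply: measurable_fun_limn_esup => n; apply: measurableT_comp.
have g0 w : (0 <= g w)%E.
  rewrite /g limn_einf_lim; apply: lime_ge; first exact: is_cvg_einfs.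
  by apply: nearW => n; apply/ereal_infP => _ [k _ <-]; exact: f0.
have ig : (\int[P]_w g w <= C%:E)%E.
  apply: le_trans (fatou _ _ _ _) _ => //.
  rewrite limn_einf_lim; apply: lime_le; first exact: is_cvg_einfs.
  apply: nearW => n; apply: le_trans (fC n).
  by apply: ereal_inf_lbound; exists n => //=.
have : P.-integrable setT g.
  apply/integrableP; split => //.
  under eq_integral do rewrite gee0_abs//.
  by rewrite (le_lt_trans ig)// ltry.
move=> /(integrable_ae measurableT); apply: filterS => w /(_ I) gw.
exists (fine (g w) + 1); split; first by rewrite ltr_wpDl// fine_ge0.
move=> n0; have : (einfs (f^~ w) n0 < (fine (g w) + 1)%:E)%E.
  apply: (@le_lt_trans _ _ (g w)).
    rewrite /g limn_einf_lim; have /cvg_lim -> // := @cvg_einfs_sup _ (f^~ w).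
    by apply: ereal_sup_ubound; exists n0.
  by rewrite EFinD fineK// lteDl.
move=> /ereal_inf_lt[_ [m /= nm <-] fm].
by exists m; split=> //; exact: ltW.
Qed.

Lemma integral_sum_indic d (T : measurableType d) (R : realType)
    (P : probability T R) (K : finType) (c : K -> R) (A : K -> set T) :
  (forall x, 0 <= c x) -> (forall x, measurable (A x)) ->
  (\int[P]_w (\sum_x c x * \1_(A x) w)%:E = (\sum_x c x * fine (P (A x)))%:E)%E.
Proof.
move=> c0 mA; under eq_integral do rewrite -sumEFin.
rewrite ge0_integral_sum//; last 2 first.
- move=> x; apply/measurable_EFinP/measurable_funM => //; exact: measurable_indic.
- by move=> x w _; rewrite lee_fin mulr_ge0// indicE.
rewrite -sumEFin; apply: eq_bigr => x _.
under eq_integral do rewrite EFinM.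
rewrite ge0_integralZl//=.
- by rewrite integral_indic// setIT EFinM fineK// fin_num_measure.
- by apply/measurable_EFinP; exact: measurable_indic.
- by rewrite lee_fin.
Qed.

Lemma measurable_exists_fin d (T : measurableType d) (K : finType)
    (A : K -> set T) : (forall y, measurable (A y)) ->
  measurable [set w | exists y, A y w].
Proof.
move=> mA; rewrite (_ : [set w | _] = \bigcup_(y in [set: K]) A y).
  by apply: fin_bigcup_measurable => // y _.
by apply/seteqP; split=> w [y]; [exists y|move=> _; exists y].
Qed.

Lemma Boole_fin d (T : measurableType d) (R : realType) (P : {measure set T -> \bar R})
    (K : finType) (A : K -> set T) : (forall y, measurable (A y)) ->
  (P [set w | exists y, A y w] <= \sum_y P (A y))%E.
Proof.
move=> mA; rewrite (_ : [set w | _] = \big[setU/set0]_(y <- index_enum K) A y).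
  elim: (index_enum K) => [|y s IH]; first by rewrite !big_nil measure0.
  rewrite !big_cons; apply: le_trans (measureU2 _ _ _) _ => //.
    exact: bigsetU_measurable.
  exact: leeD2l.
rewrite -bigcup_seq; apply/seteqP; split=> w [y Ayw]; last by exists y.
by exists y => //=; rewrite mem_index_enum.
Qed.

(** * Grids in the unit cube *)

Section grid.
Variable R : realType.
Implicit Types (x a : R).

Lemma card_close n (i : 'I_n) x : 0 <= x ->
  #|[pred i' : 'I_n | `|(i : nat)%:R - (i' : nat)%:R| <= x]|%:R <= 1 + 2 * x.
Proof.
move=> x0; set A := [pred _ | _]; pose b := Num.truncn x.
have bx : b%:R <= x by rewrite truncn_le.
have xb : x < b%:R + 1 by rewrite natr1 truncnS_gt.
have Ab i' : i' \in A -> (i' <= i + b)%N /\ (i <= i' + b)%N.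
  rewrite inE ler_norml => /andP[h1 h2].
  by split; rewrite -ltnS -(ltr_nat R) -natr1 natrD; lra.
(* The indices within [b] of [i] are translated into [[0, 2 b]]. *)
pose g (i' : 'I_n) : 'I_(2 * b).+1 := inord (i' + b - i).
have gi : {in A &, injective g}.
  move=> u v /Ab[u1 u2] /Ab[v1 v2] /(congr1 val) /=.
  rewrite !inordK; [|lia|lia] => h; apply/val_inj => /=; lia.
have := max_card (mem [seq g i' | i' in A]);
  rewrite (card_in_image gi) card_ord -(ler_nat R) => /le_trans; apply.
by rewrite -natr1 natrM addrC lerD2l ler_wpM2l.
Qed.

Variables (N : nat) (n : 'I_N -> nat).
Let I := {dffun forall j : 'I_N, 'I_(n j)}.

Lemma card_dffun_forall (r : forall j, pred 'I_(n j)) :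
  #|[pred f : I | [forall j, r j (f j)]]| = (\prod_j #|r j|)%N.
Proof.
transitivity #|(family (fun j => r j) : simpl_pred I)|.
  by apply: eq_card => f; rewrite !inE.
by rewrite card_family foldrE big_map big_enum.
Qed.

(** The factor [a] shrinks the grid, so that all its pairs can be brought within [delta0], the range
    of the increment hypothesis. *)
Definition grid_point a (f : I) : 'rV[R]_N :=
  \row_j (a * (f j : nat)%:R / (n j)%:R).

Lemma grid_point_cube a f : 0 <= a <= 1 -> unit_cube (grid_point a f).
Proof.
move=> /andP[a0 a1] j; rewrite mxE.
have nj : (0 < n j)%N by apply: leq_ltn_trans (ltn_ord (f j)).
rewrite divr_ge0 ?mulr_ge0//= ler_pdivrMr ?ltr0n// mul1r.
apply: (@le_trans _ _ (1 * (f j : nat)%:R)); first by rewrite ler_wpM2r.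
by rewrite mul1r ler_nat ltnW.
Qed.

Lemma grid_point_dist a f f' j : 0 <= a <= 1 ->
  `|grid_point a f 0 j - grid_point a f' 0 j| <= a.
Proof.
move=> a01; have h g : 0 <= grid_point a g 0 j <= a.
  have nj : (0 < n j)%N by apply: leq_ltn_trans (ltn_ord (g j)).
  case/andP: a01 => a0 _; rewrite mxE divr_ge0 ?mulr_ge0//= ler_pdivrMr ?ltr0n//.
  by rewrite ler_wpM2l// ler_nat ltnW.
have /andP[h1 h2] := h f; have /andP[h3 h4] := h f'.
by rewrite ler_norml; apply/andP; split; lra.
Qed.

Lemma card_grid_close a (f : I) (l : 'I_N -> R) : 0 < a -> (forall j, 0 <= l j) ->
  #|[pred f' : I | [forall j, `|grid_point a f 0 j - grid_point a f' 0 j| <= l j]]|%:R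
    <= \prod_j (1 + 2 * (l j * (n j)%:R / a)).
Proof.
move=> a0 l0.
pose r j : pred 'I_(n j) := fun i' =>
   `|grid_point a f 0 j - a * (i' : nat)%:R / (n j)%:R| <= l j.
rewrite (_ : #|_| = #|[pred f' : I | [forall j, r j (f' j)]]|); last first.
  apply: eq_card => f'; rewrite !inE; apply: eq_forallb => j.
  by rewrite /r [grid_point a f' 0 j]mxE.
rewrite card_dffun_forall.
rewrite natr_prod; apply: ler_prod => j _; rewrite ler0n/=.
have nj : (0 < n j)%N by apply: leq_ltn_trans (ltn_ord (f j)).
apply: le_trans (card_close (f j) _); last by rewrite divr_ge0 ?mulr_ge0// ltW.
rewrite ler_nat subset_leq_card//; apply/fintype.subsetP => i';
  rewrite !inE /r unfold_in mxE.
rewrite -mulrBl -mulrBr normrM normrM normfV (gtr0_norm a0) normr_nat.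
by rewrite ler_pdivrMr ?ltr0n// ler_pdivlMr// mulrC.
Qed.

Lemma card_grid : #|{: I}|%:R = \prod_j (n j)%:R :> R.
Proof.
rewrite -natr_prod; congr (_%:R).
transitivity #|[pred f : I | [forall j, xpredT (f j)]]|.
  by apply: eq_card => f; rewrite !inE; apply/esym/forallP.
by rewrite (card_dffun_forall (fun j => xpredT)); apply: eq_bigr => j _;
  rewrite card_ord.
Qed.

(** As [e j <= M j], the radius [2^(-e j)] is not much finer than the grid:
    [n j * 2^(-e j) >= 1 / 2], which absorbs the 1 of each one-dimensional count. *)
Lemma card_grid_close_pow a (f : I) (e M : 'I_N -> R) : 0 < a ->
  (forall j, 2 `^ M j <= 2 * (n j)%:R) -> (forall j, e j <= M j) ->
  #|[pred f' : I | [forall j, `|grid_point a f 0 j - grid_point a f' 0 j| <= 2 `^ (- e j)]]|%:R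
    <= (2 + 2 / a) ^+ N * #|{: I}|%:R * 2 `^ (- \sum_j e j).
Proof.
move=> a0 nM eM.
apply: le_trans (card_grid_close _ a0 _) _; first by move=> j; exact: powR_ge0.
rewrite card_grid -[X in _ ^+ X]card_ord -prodr_const -big_split/=.
rewrite -sumrN powR2_sum -big_split/=; apply: ler_prod => j _.
have ej0 := powR_ge0 2 (- e j).
apply/andP; split.
  by rewrite addr_ge0// mulr_ge0// divr_ge0 ?mulr_ge0// ltW.
have : 1 <= 2 * ((n j)%:R * 2 `^ (- e j)).
  apply: (@le_trans _ _ (2 `^ (M j) * 2 `^ (- M j))).
    by rewrite powRN mulfV// gt_eqF// powR_gt0.
  rewrite mulrA ler_pM ?powR_ge0// ler_powR// ?ler1n// lerN2.
  exact: eM.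
set u := 2 `^ (- e j) in ej0 *; set v := (n j)%:R => h.
have -> : (2 + 2 / a) * v * u = 2 * (v * u) + 2 * (u * v / a) by ring.
by rewrite lerD2r.
Qed.
End grid.

(** * Counting the close pairs of grid points *)

Section grid_energy.
Variable R : realType.

Local Notation grid nj := {dffun forall j, 'I_(nj j)}.

(* For [L = 0] this is no constraint on the unit cube; for [L = 1] it is the time
   part of the closeness of two points of the graph. *)
Definition window N (L : nat) n (s t : 'rV[R]_N) : bool :=
  [forall j, `|s 0 j - t 0 j| <= 2 `^ (- (L * n)%:R)].

(* The hypothesis on [D0] reads [D0 <= g(b / (b + k))], multiplied by [b + k]; it
   is used with [b + k = n], where [2^(k-n)] is the size of [rho(s, t)]. *)
Lemma grid_energy N p (H : 'I_N -> R) (L : nat) (D0 a C : R) m n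
    (nj : 'I_N -> nat) (pr : grid nj -> grid nj -> R) :
  (forall j, 0 < H j <= 1) -> (L <= 1)%N -> (n <= m)%N -> 0 < a -> 0 <= C ->
  (forall j, 2 `^ (m%:R / H j) <= 2 * (nj j)%:R) ->
  (forall b k, D0 * (b + k)%:R <=
     \sum_j Num.max (L * (b + k))%:R (b%:R / H j) + (k * p)%:R) ->
  (forall i i', pr i i' <= (window L n (grid_point a i) (grid_point a i'))%:R *
     \sum_(k < n.+1) [forall j, `|grid_point a i 0 j - grid_point a i' 0 j| <=
         2 `^ (- ((n - k)%:R / H j))]%:R * (C * (2 ^- k) ^+ p)) ->
  \sum_i \sum_i' pr i i' <= C * (2 + 2 / a) ^+ N * (n.+1%:R * 2 `^ (- (D0 * n%:R)))
     * #|{: grid nj}|%:R ^+ 2.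
Proof.
move=> H01 L1 nm a0 C0 njH gD pr_le.
set K := C * (2 + 2 / a) ^+ N.
suff one i : \sum_i' pr i i' <= K * (n.+1%:R * 2 `^ (- (D0 * n%:R))) * #|{: grid nj}|%:R.
  apply: le_trans (ler_sum _ (fun i _ => one i)) _.
  by rewrite sumr_const -[leLHS]mulr_natr -[leLHS]mulrA -expr2.
apply: le_trans (ler_sum _ (fun i' _ => pr_le i i')) _.
under eq_bigr do rewrite mulr_sumr.
rewrite exchange_big/=.
(* The bound is the same for every [k], whence the factor [n.+1]. *)
apply: (@le_trans _ _ (\sum_(k < n.+1) K * 2 `^ (- (D0 * n%:R)) * #|{: grid nj}|%:R)).
  apply: ler_sum => k _.
  have kn : (k <= n)%N by rewrite -ltnS.
  (* The window and the [k]-th condition together confine [i'] to a box of radii [2^(-e j)] around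
     [i]. *)
  pose e j := Num.max (L * n)%:R ((n - k)%:R / H j) : R.
  have em j : e j <= m%:R / H j.
    have /andP[Hj0 Hj1] := H01 j; rewrite ge_max; apply/andP; split.
      rewrite ler_pdivlMr//; apply: (@le_trans _ _ ((L * n)%:R * 1)).
        by rewrite ler_wpM2l.
      by rewrite mulr1 ler_nat; case: L L1 {gD pr_le e} => [|[|]]// _;
        rewrite mul1n.
    by rewrite ler_pM2r ?invr_gt0// ler_nat (leq_trans (leq_subr _ _)).
  have := card_grid_close_pow i a0 njH em.
  set cnt := #|_|%:R => cntle.
  apply: (@le_trans _ _ (cnt * (C * (2 ^- k) ^+ p))).
    rewrite /cnt -sum1_card natr_sum mulr_suml [leRHS]big_mkcond/=.
    apply: ler_sum => i' _; rewrite inE mulrA -natrM mulnb.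
    have Cp : 0 <= C * 2 ^- k ^+ p
      by rewrite mulr_ge0// exprn_ge0// invr_ge0 exprn_ge0.
    case: ifPn => [_|]; first by rewrite ler_wpM2r// ler_nat leq_b1.
    move=> notin; have -> : window L n (grid_point a i) (grid_point a i') &&
        [forall j, `|grid_point a i 0 j - grid_point a i' 0 j| <=
           2 `^ (- ((n - k)%:R / H j))] = false.
      apply/negP => /andP[/forallP hw /forallP hq]; case/negP: notin.
      by apply/forallP => j; rewrite /e maxEle; case: ifP => _.
    by rewrite mul0r.
  apply: le_trans (ler_wpM2r _ cntle) _.
    by rewrite mulr_ge0// exprn_ge0// invr_ge0 exprn_ge0.
  have -> : (2 + 2 / a) ^+ N * #|{: grid nj}|%:R * 2 `^ (- \sum_j e j) * (C * 2 ^- k ^+ p) =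
     K * (2 `^ (- \sum_j e j) * 2 ^- k ^+ p) * #|{: grid nj}|%:R by rewrite /K;
       ring.
  rewrite ler_wpM2r// ler_wpM2l//.
    by rewrite /K mulr_ge0// exprn_ge0// addr_ge0// divr_ge0// ltW.
  rewrite powR2N -powR_mulrn ?powR_ge0// -powRrM -powR2D.
  rewrite ler_powR ?ler1n//.
  have := gD (n - k)%N k; rewrite subnK//.
  rewrite mulNr -(natrM _ k p) -[X in _ <= X + _]/(\sum_j e j); lra.
rewrite sumr_const card_ord -[leLHS]mulr_natr le_eqVlt; apply/orP; left; apply/eqP.
ring.
Qed.

End grid_energy.

(** * Anisotropic meshes and chaining *)

Section floors.
Variables (R : realType) (N : nat).
Implicit Types (t : 'rV[R]_N) (K : 'I_N -> nat).

Definition grid_floor K t : 'rV[R]_N :=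
  \row_j ((Num.truncn (t 0 j * (K j)%:R))%:R / (K j)%:R).

Local Notation index K := {dffun forall j : 'I_N, 'I_(K j).+1}.

(** The index goes up to [K j] included, so that the faces [t j = 1] carry their own nodes. *)
Definition grid_node K (i : index K) : 'rV[R]_N :=
  \row_j ((i j : nat)%:R / (K j)%:R).

Lemma grid_floor_node K t : unit_cube t -> exists i : index K, grid_floor K t = grid_node i.
Proof.
move=> ut; exists [ffun j : 'I_N =>
  inord (Num.truncn (t 0 j * (K j)%:R)) : 'I_(K j).+1].
apply/rowP => j; rewrite !mxE ffunE inordK// ltnS; exact/truncn_unit_le/ut.
Qed.

Lemma grid_floor_dist K t j : unit_cube t -> (0 < K j)%N ->
  `|t 0 j - grid_floor K t 0 j| <= (K j)%:R^-1.
Proof.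
move=> ut K0; rewrite mxE; set x := t 0 j; have /andP[x0 x1] := ut j.
have k0 : 0 < (K j)%:R :> R by rewrite ltr0n.
have xk0 : 0 <= x * (K j)%:R by rewrite mulr_ge0.
have h1 : (Num.truncn (x * (K j)%:R))%:R <= x * (K j)%:R by rewrite truncn_le.
have h2 := truncnS_gt (x * (K j)%:R); rewrite -natr1 in h2.
have -> : x - (Num.truncn (x * (K j)%:R))%:R / (K j)%:R =
    (x * (K j)%:R - (Num.truncn (x * (K j)%:R))%:R) / (K j)%:R by field;
      rewrite gt_eqF.
rewrite ger0_norm; last by rewrite divr_ge0 ?subr_ge0// ltW.
by rewrite ler_pdivrMr// mulVf ?gt_eqF//; lra.
Qed.

Lemma grid_node_cube K (i : index K) : (forall j, (0 < K j)%N) -> unit_cube (grid_node i).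
Proof.
move=> K0 j; rewrite mxE divr_ge0//= ler_pdivrMr ?ltr0n// mul1r ler_nat.
by rewrite -ltnS.
Qed.

Variable H : 'I_N -> R.
Hypothesis H_bounds : forall j, 0 < H j <= 1.

(** A displacement of [2^(-m / H j)] in direction [j] contributes [2^(-2 m)] to [aniso_sum],
    whatever [j]. *)
Definition mesh m j : nat := pow2_ceil (m%:R / H j).

Lemma mesh_floor_dist m t j : unit_cube t ->
  `|t 0 j - grid_floor (mesh m) t 0 j| <= 2 `^ (- (m%:R / H j)).
Proof.
move=> ut; apply: le_trans (grid_floor_dist ut _) _ => //.
by rewrite powRN lef_pV2 ?posrE ?powR_gt0 ?ltr0n ?pow2_ceil_ge.
Qed.

Lemma mesh_side_le m j : 2 `^ (- (m%:R / H j)) <= 2 ^- m.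
Proof.
have /andP[Hj0 Hj1] := H_bounds j.
rewrite powR2N ler_powR ?ler1n// lerN2 ler_pdivlMr//.
by rewrite ler_piMr.
Qed.

Lemma mesh_side_anti m m' j : (m <= m')%N ->
  2 `^ (- (m'%:R / H j)) <= 2 `^ (- (m%:R / H j)) :> R.
Proof.
move=> mm; have /andP[Hj0 Hj1] := H_bounds j.
by rewrite ler_powR ?ler1n// lerN2 ler_pM2r ?invr_gt0// ler_nat.
Qed.

(** The factor 3 collects the distance between two points at level [m] and the errors made in
    rounding each of them to a node. *)
Definition near_nodes m (s t : 'rV[R]_N) : bool :=
  [forall j, `|s 0 j - t 0 j| <= 3 * 2 `^ (- (m%:R / H j))].

(* Only the increments between consecutive grids are controlled; the sum of
   their bounds along [grid_floor (mesh m) t --> t] is geometric. *)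
Lemma chaining (f : 'rV[R]_N -> R) (rho : R) m0 : continuous f -> 0 < rho < 1 ->
  (forall m, (m0 <= m)%N -> forall (i : index (mesh m.+1)) (i' : index (mesh m)),
     near_nodes m (grid_node i) (grid_node i') ->
     `|f (grid_node i) - f (grid_node i')| <= rho ^+ m) ->
  forall m s t, (m0 <= m)%N -> unit_cube s -> unit_cube t ->
    (forall j, `|s 0 j - t 0 j| <= 2 `^ (- (m%:R / H j))) ->
    `|f s - f t| <= (1 + 2 / (1 - rho)) * rho ^+ m.
Proof.
move=> cf /andP[r0 r1] step.
have r10 : 0 < 1 - rho by rewrite subr_gt0.
have close m s t : (m0 <= m)%N -> unit_cube s -> unit_cube t ->
    (forall j, `|s 0 j - t 0 j| <= 2 `^ (- (m%:R / H j))) ->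
    `|f (grid_floor (mesh m.+1) s) - f (grid_floor (mesh m) t)| <= rho ^+ m.
  move=> mm us ut st; have [i Ei] := grid_floor_node (mesh m.+1) us.
  have [i' Ei'] := grid_floor_node (mesh m) ut.
  rewrite Ei Ei'; apply: step => //; rewrite -Ei -Ei'; apply/forallP => j.
  have h1 := mesh_floor_dist m.+1 j us; have h2 := mesh_floor_dist m j ut.
  have h3 := mesh_side_anti j (leqnSn m); have h4 := st j.
  set u := grid_floor _ _ 0 j in h1 *; set v := grid_floor _ _ 0 j in h2 *.
  have -> : u - v = (t 0 j - v) + ((s 0 j - t 0 j) - (s 0 j - u)) by ring.
  apply: le_trans (ler_normD _ _) _;
    apply: le_trans (lerD (lexx _) (ler_normB _ _)) _.
  lra.
(* Telescoping along successive levels; the geometric sum is kept in closed form so that the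
   induction closes. *)
have chain m k t : (m0 <= m)%N -> unit_cube t ->
    `|f (grid_floor (mesh (m + k)) t) - f (grid_floor (mesh m) t)| <=
    (rho ^+ m - rho ^+ (m + k)) / (1 - rho).
  move=> mm ut; elim: k => [|k IH]; first by rewrite addn0 !subrr normr0 mul0r.
  have tt j : `|t 0 j - t 0 j| <= 2 `^ (- ((m + k)%:R / H j)).
    by rewrite subrr normr0 powR_ge0.
  have h := close (m + k)%N t t (leq_trans mm (leq_addr _ _)) ut ut tt.
  rewrite addnS; set u := f _ in h *; set v := f _ in h IH *; set z := f _ in IH *.
  have -> : u - z = (u - v) + (v - z) by ring.
  apply: le_trans (ler_normD _ _) _; apply: le_trans (lerD h IH) _.
  rewrite le_eqVlt; apply/orP; left; apply/eqP; rewrite exprS; field.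
  by rewrite gt_eqF.
(* The nodes of level [m + k] tend to [t], and [f] is continuous. *)
have limit m t : (m0 <= m)%N -> unit_cube t ->
    `|f t - f (grid_floor (mesh m) t)| <= rho ^+ m / (1 - rho).
  move=> mm ut; apply/ler_addgt0Pr => e e0.
  have /cvgrPdist_lt/(_ _ e0)/nbhs_ballP[r /= r_gt0 fr] := cf t.
  have [k kr] := exists_pow2N_lt r_gt0.
  set u := grid_floor (mesh (m + k)) t.
  have : `|f t - f u| < e.
    apply: fr; split => // i j; rewrite ord1 /ball/=.
    apply: le_lt_trans (mesh_floor_dist (m + k)%N j ut) _.
    apply: le_lt_trans (mesh_side_le _ _) _; apply: le_lt_trans kr.
    by rewrite lef_pV2 ?posrE ?exprn_gt0// ler_eXn2l ?ltr1n// leq_addl.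
  have h := chain m k t mm ut; rewrite -/u in h.
  have -> : f t - f (grid_floor (mesh m) t) =
    (f t - f u) + (f u - f (grid_floor (mesh m) t)) by ring.
  move=> h1; apply: le_trans (ler_normD _ _) _; rewrite addrC; apply: lerD (ltW h1).
  by apply: le_trans h _; rewrite ler_pM2r ?invr_gt0// gerBl exprn_ge0// ltW.
(* The path goes from [s] to its node of level [m + 1], across to the node of [t] of level [m], then
   to [t]: only nodes of consecutive levels are compared. *)
move=> m s t mm us ut st.
have h1 := limit m.+1 s (leq_trans mm (leqnSn _)) us.
have h2 := limit m t mm ut; have h3 := close _ _ _ mm us ut st.
set u := f (grid_floor _ s) in h1 h3 *; set v := f (grid_floor _ t) in h2 h3 *.
have -> : f s - f t = (f s - u) + ((u - v) - (f t - v)) by ring.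
apply: le_trans (ler_normD _ _) _;
  apply: le_trans (lerD (lexx _) (ler_normB _ _)) _.
have h4 : rho ^+ m.+1 / (1 - rho) <= rho ^+ m / (1 - rho).
  by rewrite ler_pM2r ?invr_gt0// exprS ler_piMl ?exprn_ge0// ltW.
rewrite mulrDl mul1r (_ : 2 / (1 - rho) * rho ^+ m = 2 * (rho ^+ m / (1 - rho)));
  last by ring.
lra.
Qed.
End floors.
Arguments grid_node {R N K}.

(** * Covering and exponents *)

Section cover.
Variable R : realType.
Variables (N p q : nat) (H : 'I_N -> R) (H_bounds : forall j, 0 < H j <= 1).
Variables (x : 'I_p -> 'rV[R]_N -> R) (F : 'rV[R]_N -> 'rV[R]_q).
Variables (eps C : R) (m0 L : nat).
Hypotheses (eps01 : 0 < eps < 1) (C1 : 1 <= C) (L1 : (L <= 1)%N).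
Hypothesis modulus : forall i m s t, (m0 <= m)%N ->
  unit_cube s -> unit_cube t ->
  (forall j, `|s 0 j - t 0 j| <= 2 `^ (- (m%:R / H j))) ->
  `|x i s - x i t| <= C * (2 `^ (eps - 1)) ^+ m.
Hypothesis F_close : forall s t n, unit_cube s -> unit_cube t ->
  (forall i, `|x i s - x i t| <= 2 ^- n) -> window L n s t ->
  forall l, `|F s 0 l - F t 0 l| <= 2 ^- n.

(** The function [g] whose minimum over [[0, 1]] is the dimension. *)
Definition exponent (theta : R) : R :=
  \sum_j Num.max L%:R (theta / H j) + (1 - theta) * p%:R.

(* A piece is indexed by a cell of the cube and, for each coordinate field, by the
   interval of length [2^-n] containing its increment from a base point of that
   cell. *)
Lemma cover_at_scale (theta : R) n (m := Num.truncn (theta * n%:R)) :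
  0 < theta <= 1 -> (m0 <= m)%N ->
  exists (K : finType) (V : K -> set 'rV[R]_q),
    [/\ F @` @unit_cube R N `<=` [set y | exists k, V k y],
     forall k, (diam (V k) <= (q.+1%:R * 2 ^- n)%:E)%E &
     #|K|%:R <= 3 ^+ N * (6 * C) ^+ p * 2 `^ ((exponent theta + p%:R * eps) * n%:R)].
Proof.
move=> /andP[th0 th1] m0m; have /andP[eps0 eps1] := eps01.
have mth : m%:R <= theta * n%:R by rewrite truncn_le// mulr_ge0// ltW.
have thm : theta * n%:R < m%:R + 1 by rewrite natr1 truncnS_gt.
have mn : m%:R <= n%:R :> R by apply: le_trans mth _; rewrite ler_piMl.
pose e j := Num.max (L * n)%:R (m%:R / H j) : R.
have e0 j : 0 <= e j by rewrite le_max ler0n.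
(* Bound on the oscillation of each coordinate field over a cell. *)
pose O := C * (2 `^ (eps - 1)) ^+ m.
have C0 : 0 < C by apply: lt_le_trans C1.
have O0 : 0 <= O by rewrite mulr_ge0 ?exprn_ge0 ?powR_ge0// ltW.
pose Lam := Num.truncn (2 * O * 2 ^+ n).
pose K1 : finType := {dffun forall j : 'I_N, 'I_(pow2_ceil (e j)).+1}.
pose K : finType := (K1 * {ffun 'I_p -> 'I_Lam.+1})%type.
pose cell (k : K1) : set 'rV[R]_N := [set t | unit_cube t /\
  forall j, Num.truncn (t 0 j * (pow2_ceil (e j))%:R) = k j].
(* Base point of the cell; the default 0 arises only for empty cells, whose pieces are empty. *)
pose c k := xget 0 (cell k).
(* Adding [O] makes the increment nonnegative, so that truncation is a floor; the keys lie in
   [[0, 2 O 2^n]], whence [Lam]. *)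
pose key i (t s : 'rV[R]_N) := (x i t - x i s + O) * 2 ^+ n.
pose U (k : K) : set 'rV[R]_N := [set t | cell k.1 t /\
  forall i, Num.truncn (key i t (c k.1)) = k.2 i].
have cell_dist k s t : cell k s -> cell k t -> forall j, `|s 0 j - t 0 j| <= 2 `^ (- e j).
  move=> [us ks] [ut kt] j.
  have k0 : 0 < (pow2_ceil (e j))%:R :> R by rewrite ltr0n.
  have /andP[s0 _] := us j; have /andP[t0 _] := ut j.
  have := truncn_eq_dist (mulr_ge0 s0 (ltW k0)) (mulr_ge0 t0 (ltW k0)).
  rewrite ks kt => /(_ erefl); rewrite -mulrBl normrM (gtr0_norm k0).
  rewrite -ler_pdivlMr// mul1r => /le_trans; apply.
  by rewrite powRN lef_pV2 ?posrE ?powR_gt0 ?pow2_ceil_ge.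
have cell_m k s t : cell k s -> cell k t -> forall j, `|s 0 j - t 0 j| <= 2 `^ (- (m%:R / H j)).
  move=> ks kt j; apply: le_trans (cell_dist _ _ _ ks kt j) _.
  by rewrite ler_powR ?ler1n// lerN2 le_max lexx orbT.
have cell_O k s t i : cell k s -> cell k t -> `|x i s - x i t| <= O.
  move=> ks kt; apply: modulus => //; [exact: ks.1|exact: kt.1|exact: cell_m kt].
have cc k t : cell k t -> cell k (c k) by move=> kt; exact: (xgetI _ kt).
have key_ge0 k t i : cell k t -> 0 <= key i t (c k).
  move=> kt; rewrite mulr_ge0 ?exprn_ge0//.
  by have := cell_O _ _ _ i kt (cc _ _ kt); rewrite ler_norml => /andP[]; lra.
have key_le k t i : cell k t -> key i t (c k) <= 2 * O * 2 ^+ n.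
  move=> kt; rewrite ler_wpM2r ?exprn_ge0//.
  by have := cell_O _ _ _ i kt (cc _ _ kt); rewrite ler_norml => /andP[]; lra.
exists K, (fun k => F @` U k); split.
- move=> _ [t ut <-].
  pose k1 : K1 := [ffun j : 'I_N =>
    inord (Num.truncn (t 0 j * (pow2_ceil (e j))%:R))
     : 'I_(pow2_ceil (e j)).+1].
  have kt : cell k1 t.
    split=> // j; rewrite ffunE inordK// ltnS; exact/truncn_unit_le/ut.
  pose k2 := [ffun i : 'I_p => inord (Num.truncn (key i t (c k1))) : 'I_Lam.+1].
  exists (k1, k2), t => //; split=> //= i; rewrite ffunE inordK// ltnS.
  by apply: le_truncn; exact: key_le.
- move=> k; apply/ereal_supP => _ [_ [s [ks s2] <-] [_ [t [kt t2] <-] <-]].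
  rewrite lee_fin; apply: euclid_dist_le_coord; first by rewrite invr_ge0 exprn_ge0.
  apply: F_close; [exact: ks.1|exact: kt.1| |].
    move=> i; have := truncn_eq_dist (key_ge0 _ _ i ks) (key_ge0 _ _ i kt).
    rewrite s2 t2 => /(_ erefl); rewrite -mulrBl.
    have -> : x i s - x i (c k.1) + O - (x i t - x i (c k.1) + O) = x i s - x i t by ring.
    rewrite normrM (gtr0_norm (_ : 0 < 2 ^+ n)) ?exprn_gt0// -ler_pdivlMr ?exprn_gt0//.
    by rewrite mul1r.
  apply/forallP => j; apply: le_trans (cell_dist _ _ _ ks kt j) _.
  by rewrite ler_powR ?ler1n// lerN2 le_max lexx.
rewrite card_prod natrM card_ffun !card_ord natrX.
apply: (@le_trans _ _ ((3 ^+ N * 2 `^ (\sum_j e j)) *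
    (6 * C * 2 `^ (n%:R - theta * n%:R * (1 - eps))) ^+ p)).
  rewrite ler_pM ?card_pow2_ceil// lerXn2r ?nnegrE ?mulr_ge0 ?powR_ge0// ?(ltW C0)//.
  have OE : O * 2 ^+ n = C * 2 `^ (n%:R - m%:R * (1 - eps)).
    rewrite /O -!powR_mulrn ?powR_ge0// -powRrM -mulrA -powR2D.
    by congr (_ * _ `^ _); ring.
  (* Holds because [m <= n]; it absorbs the rounding in [Lam.+1]. *)
  have h1 : 1 <= O * 2 ^+ n.
    have me : 0 <= m%:R * eps by rewrite mulr_ge0// ltW.
    by rewrite OE mulr_ege1// powR2_ge1//; lra.
  have h2 : (Lam.+1)%:R <= 3 * (O * 2 ^+ n).
    rewrite -natr1; have : Lam%:R <= 2 * O * 2 ^+ n.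
      by rewrite truncn_le; apply: mulr_ge0; [exact: mulr_ge0|exact: exprn_ge0].
    lra.
  apply: le_trans h2 _; rewrite OE.
  (* Since [m > theta n - 1], replacing [m] by [theta n] costs a factor at most 2, whence
     [6 = 3 * 2]. *)
  have -> : 6 * C * 2 `^ (n%:R - theta * n%:R * (1 - eps)) =
     3 * (C * 2 `^ (1 + (n%:R - theta * n%:R * (1 - eps)))).
    by rewrite (powR2D 1) powRr1//; ring.
  have h3 : (theta * n%:R - m%:R) * (1 - eps) <= 1 * (1 - eps).
    by rewrite ler_wpM2r//; lra.
  by rewrite ler_pM2l// ler_pM2l// ler_powR ?ler1n//; lra.
rewrite exprMn mulrACA -(powR_mulrn p (powR_ge0 2 _)) -powRrM -powR2D.
have A0 : 0 <= 3 ^+ N * (6 * C) ^+ p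
  by rewrite mulr_ge0 ?exprn_ge0// mulr_ge0// ltW.
rewrite ler_wpM2l// ler_powR ?ler1n//.
have se : \sum_j e j <= (\sum_j Num.max L%:R (theta / H j)) * n%:R.
  rewrite mulr_suml; apply: ler_sum => j _; have /andP[Hj0 Hj1] := H_bounds j.
  rewrite /e ge_max natrM; apply/andP; split.
    by rewrite ler_wpM2r// le_max lexx.
  apply: (@le_trans _ _ (theta / H j * n%:R)).
    by rewrite mulrAC ler_pM2r ?invr_gt0.
  by rewrite ler_wpM2r// le_max lexx orbT.
rewrite /exponent; have p0 : 0 <= p%:R :> R by [].
have n0 : 0 <= n%:R :> R by [].
have : theta * n%:R * eps * p%:R <= n%:R * eps * p%:R.
  by rewrite ler_wpM2r// ler_wpM2r ?(ltW eps0)// ler_piMl.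
lra.
Qed.

Lemma exponent_ge0 (theta : R) : 0 <= theta <= 1 -> 0 <= exponent theta.
Proof.
move=> /andP[th0 th1]; rewrite addr_ge0 ?mulr_ge0 ?subr_ge0//.
by apply: sumr_ge0 => j _; rewrite le_max ler0n.
Qed.

(** The margin between [s] and the exponent leaves a factor [2^(-(s - g) n)], which beats all
    constants as [n] grows. *)
Lemma hausdorff_dim_image_le_exponent (theta s : R) : 0 < theta <= 1 ->
  exponent theta + p%:R * eps < s ->
  (hausdorff_dim (F @` @unit_cube R N) <= s%:E)%E.
Proof.
move=> th01 gs; have /andP[th0 th1] := th01; have /andP[eps0 eps1] := eps01.
have g0 : 0 <= exponent theta + p%:R * eps.
  by rewrite addr_ge0 ?exponent_ge0 ?(ltW th0)// mulr_ge0// ltW.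
have s0 : 0 <= s by apply: le_trans g0 (ltW gs).
set g := exponent theta + p%:R * eps in gs g0 *.
have C0 : 0 < C by apply: lt_le_trans C1.
pose A0 := 3 ^+ N * (6 * C) ^+ p.
have A00 : 0 < A0 by rewrite mulr_gt0 ?exprn_gt0// mulr_gt0.
pose A1 := A0 * q.+1%:R `^ s.
have A10 : 0 < A1 by rewrite mulr_gt0// powR_gt0.
apply: hausdorff_dim_le => // e e0.
have [k1 k1e] : exists k, 2 ^- k < e / q.+1%:R.
  by apply: exists_pow2N_lt; rewrite divr_gt0.
have [k2 k2e] : exists k, 2 ^- k < e / A1 by apply: exists_pow2N_lt;
  rewrite divr_gt0.
(* The three summands ensure in turn that the level [truncn (theta n)] reaches [m0], that diameters
   are at most [e], and that [A1 2^(-(s - g) n) <= e]. *)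
pose n := ((Num.truncn (m0%:R / theta)).+1 + k1 + (Num.truncn (k2%:R / (s - g))).+1)%N.
have n1 : ((Num.truncn (m0%:R / theta)).+1 <= n)%N by rewrite /n -addnA leq_addr.
have n2 : (k1 <= n)%N by apply: leq_trans (leq_addr _ _); exact: leq_addl.
have n3 : ((Num.truncn (k2%:R / (s - g))).+1 <= n)%N by exact: leq_addl.
move: n n1 n2 n3 => n n1 n2 n3.
have m0n : (m0 <= Num.truncn (theta * n%:R))%N.
  rewrite -[m0](@natrK R); apply: le_truncn; rewrite mulrC -ler_pdivrMr//.
  by apply: le_trans (ltW (truncnS_gt _)) _; rewrite ler_nat.
have k2n : k2%:R <= (s - g) * n%:R.
  rewrite mulrC -ler_pdivrMr ?subr_gt0//.
  by apply: le_trans (ltW (truncnS_gt _)) _; rewrite ler_nat.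
have [K [V [FV Vd KA]]] := cover_at_scale th01 m0n.
have pn0 : 0 < 2 ^- n :> R by rewrite invr_gt0 exprn_gt0.
exists K, V, (q.+1%:R * 2 ^- n); split => //.
  rewrite mulr_ge0 ?(ltW pn0)//= mulrC -ler_pdivlMr//; apply: le_trans (ltW k1e).
  by rewrite lef_pV2 ?posrE ?exprn_gt0// ler_eXn2l ?ltr1n.
apply: (@le_trans _ _ (A0 * 2 `^ (g * n%:R) * (q.+1%:R * 2 ^- n) `^ s)).
  by rewrite ler_wpM2r ?powR_ge0.
rewrite powRM ?(ltW pn0)// powR2N -powRrM.
have -> : A0 * 2 `^ (g * n%:R) * (q.+1%:R `^ s * 2 `^ (- n%:R * s)) =
    A1 * 2 `^ (- ((s - g) * n%:R)).
  have -> : - ((s - g) * n%:R) = g * n%:R + - n%:R * s by ring.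
  by rewrite powR2D /A1; ring.
rewrite mulrC -ler_pdivlMr//; apply: le_trans (ltW k2e).
by rewrite powR2N ler_powR ?ler1n// lerN2.
Qed.
End cover.

(** * Minimization of the exponent *)

Section exponent.
Variables (R : realType) (N p : nat) (H : 'I_N -> R).
Hypothesis H_bounds : forall j, 0 < H j <= 1.
Hypothesis p_gt0 : (0 < p)%N.
Implicit Types (theta tau D : R).

Let H_gt0 j : 0 < H j. Proof. by case/andP: (H_bounds j). Qed.

Lemma exponent0E theta : 0 <= theta ->
  exponent p H 0 theta = theta * \sum_j (H j)^-1 + (1 - theta) * p%:R.
Proof.
move=> th0; rewrite /exponent mulr_sumr; congr (_ + _).
by apply: eq_bigr => j _; rewrite max_r// divr_ge0// ltW.
Qed.

(** At a tie [tau = H j] both arguments of the maximum agree, so one set [S] serves on a closed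
    interval of [tau], endpoints included, where the exponent is affine. *)
Lemma exponent1_piecewise (S : pred 'I_N) tau :
  (forall j, S j -> H j <= tau) -> (forall j, ~~ S j -> tau <= H j) ->
  exponent p H 1 tau =
  tau * (\sum_(j | S j) (H j)^-1 - p%:R) + (\sum_(j | ~~ S j) 1 + p%:R).
Proof.
move=> SH NSH; rewrite /exponent (bigID S)/=.
rewrite (eq_bigr (fun j => tau * (H j)^-1)); last first.
  by move=> j Sj; rewrite max_r// ler_pdivlMr// mul1r SH.
rewrite -mulr_sumr [X in _ + X + _](eq_bigr (fun=> 1)); last first.
  by move=> j Sj; rewrite max_l// ler_pdivrMr// mul1r NSH.
ring.
Qed.

(* On the interval between two consecutive values of [H] the exponent is affine,
   hence minimal at an endpoint; before the first value it is decreasing. *)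
Lemma exponent1_min D theta : 0 <= theta <= 1 ->
  (forall k, D <= exponent p H 1 (H k)) -> D <= exponent p H 1 1 ->
  D <= exponent p H 1 theta.
Proof.
move=> /andP[th0 th1] DH D1; pose S j := H j <= theta.
have lin tau : (forall j, S j -> H j <= tau) -> (forall j, ~~ S j -> tau <= H j) ->
    0 <= (theta - tau) * (\sum_(j | S j) (H j)^-1 - p%:R) ->
    exponent p H 1 tau <= exponent p H 1 theta.
  move=> h1 h2 h3; rewrite (exponent1_piecewise h1 h2).
  rewrite (@exponent1_piecewise S theta)//; first lra.
  by move=> j; rewrite /S -ltNge => /ltW.
(* With a nonnegative slope, move left to the largest [H k <= theta]; if there is none, the slope is
   [-p < 0], a contradiction. *)
have [sl|sl] := leP 0 (\sum_(j | S j) (H j)^-1 - p%:R).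
  have [[j0 Sj0]|noS] := pselect (exists j, S j).
    have [k Sk kmax] : exists2 k, S k & forall j, S j -> H j <= H k.
      by case: (@Order.TotalTheory.arg_maxP _ _ _ j0 S H Sj0) => k Sk kmax;
        exists k.
    apply: le_trans (DH k) (lin _ kmax _ _).
      by move=> j; rewrite /S -ltNge => /ltW; apply: le_trans.
    by rewrite mulr_ge0// subr_ge0.
  move: sl; rewrite big_pred0 ?sub0r ?oppr_ge0 ?lern0 => [/eqP p0|j].
    by move: p_gt0; rewrite p0.
  by apply/negP => Sj; apply: noS; exists j.
(* With a negative slope, move right to the smallest [H k > theta], or to 1 if there is none. *)
have [[j0 Sj0]|allS] := pselect (exists j, ~~ S j).
  have [k Sk kmin] : exists2 k, ~~ S k & forall j, ~~ S j -> H k <= H j.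
    by case: (@Order.TotalTheory.arg_minP _ _ _ j0 (fun j => ~~ S j) H Sj0) =>
      k Sk kmin; exists k.
  apply: le_trans (DH k) (lin _ _ kmin _).
    move=> j Sj; apply: le_trans Sj _; move: Sk; rewrite /S -ltNge; exact: ltW.
  rewrite mulr_le0//; last exact: ltW.
  by rewrite subr_le0; move: Sk; rewrite /S -ltNge => /ltW.
apply: le_trans D1 (lin _ _ _ _).
- by move=> j _; case/andP: (H_bounds j).
- by move=> j Sj; case: allS; exists j.
- by apply: mulr_le0; [rewrite subr_le0|exact: ltW].
Qed.

Hypothesis H_nondecreasing : forall i j : 'I_N, (i <= j)%N -> H i <= H j.

Lemma exponent1_H (k : 'I_N) :
  exponent p H 1 (H k) =
  \sum_(j < N | (j <= k)%N) H k / H j + (N - k.+1)%N%:R + (1 - H k) * p%:R.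
Proof.
rewrite (@exponent1_piecewise (fun j : 'I_N => (j <= k)%N)); last 2 first.
- by move=> j; exact: H_nondecreasing.
- by move=> j; rewrite -ltnNge => /ltnW; exact: H_nondecreasing.
rewrite -mulr_sumr; set s := \sum_(j < N | _) (H j)^-1.
(* Indices start at 0, so [k.+1] of them are at most [k]. *)
have -> : \sum_(j < N | ~~ (j <= k)%N) 1 = (N - k.+1)%N%:R :> R.
  rewrite -(big_mkord (fun j => ~~ (j <= k)%N) (fun=> 1)).
  rewrite (big_cat_nat (n := k.+1))//= big_nat_cond big_pred0 ?add0r; last first.
    by move=> j; rewrite ltnS; case: (j <= k)%N; rewrite ?andbF.
  rewrite big_nat_cond (eq_bigl (fun j => (k.+1 <= j < N)%N)); last first.
    by move=> j; rewrite -ltnNge; case: (k < j)%N; rewrite ?andbT.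
  by rewrite -big_nat big_const_nat iter_addr_0.
ring.
Qed.

Lemma exponent1_1 : exponent p H 1 1 = \sum_j (H j)^-1.
Proof.
rewrite /exponent subrr mul0r addr0; apply: eq_bigr => j _.
by rewrite mul1r max_r// invf_ge1//; case/andP: (H_bounds j).
Qed.

(** The minimum is attained at some [H k] or at 1, hence at a positive [theta], as the covering
    argument requires. *)
Lemma graph_exponent : exists D theta, [/\ 0 < theta <= 1, D = exponent p H 1 theta,
   forall tau, 0 <= tau <= 1 -> D <= exponent p H 1 tau &
   Order.min
     (\big[Order.min/+oo%E]_(k < N)
        (\sum_(j < N | (j <= k)%N) H k / H j
           + (N - k.+1)%N%:R + (1 - H k) * p%:R)%:E)
     (\sum_(j < N) (H j)^-1)%:E = D%:E].
Proof.
under eq_bigr do rewrite -exponent1_H.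
rewrite -exponent1_1; set B := \big[_/_]_(k < N) _; set E1 := exponent p H 1 1.
have Ble k : (B <= (exponent p H 1 (H k))%:E)%E by exact: bigmin_le.
(* The value [+oo] of an empty minimum is later excluded by [B <= E1%:E]. *)
have Batt : B = +oo%E \/ exists k, B = (exponent p H 1 (H k))%:E.
  rewrite /B; elim/big_rec: _ => [|k y _ [->|[k' ->]]]; first by left.
    by right; exists k; rewrite miney.
  by right; case: leP => _; [exists k|exists k'].
have [BE|EB] := leP B E1%:E; last first.
  exists E1, 1; split => //; first by rewrite ltr01 lexx.
  move=> tau tau01; apply: exponent1_min => // k.
  by rewrite -lee_fin; apply: le_trans (ltW EB) (Ble k).
case: Batt => [By|[k Bk]]; first by move: BE; rewrite By leye_eq.
exists (exponent p H 1 (H k)), (H k); split => //.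
move=> tau tau01; apply: exponent1_min => // [k'|]; rewrite -lee_fin -Bk//.
Qed.
End exponent.

(** * Random fields *)

Section increments.
Variables (R : realType) (N : nat).
Implicit Types (s t : 'rV[R]_N) (B : set R).

Definition increment_set s t B : set ('rV[R]_N -> R) := [set f | B (f t - f s)].

(** Evaluations are measurable for the product sigma-algebra, hence so are their differences;
    equality of laws and independence thus pass to increments. *)
Lemma path_measurable_increment s t B : measurable B ->
  path_measurable (increment_set s t B).
Proof.
move=> mB.
pose G : set (set ('rV[R]_N -> R)) :=
  [set C | exists t (B : set R), measurable B /\ C = [set f | B (f t)]].
pose ev u : g_sigma_algebraType G -> R := fun f => f u.
have mev u : measurable_fun setT (ev u).
  move=> _ D mD; rewrite setTI; apply: sub_sigma_algebra.
  by exists u, D.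
have mi : measurable_fun setT (fun f : g_sigma_algebraType G => ev t f - ev s f).
  exact: measurable_funB.
by have := mi measurableT _ mB; rewrite setTI.
Qed.

Lemma same_law_increment d d' (T : measurableType d) (T' : measurableType d')
    (P : probability T R) (P' : probability T' R)
    (X : 'rV[R]_N -> {RV P >-> R}) (X' : 'rV[R]_N -> {RV P' >-> R}) s t B :
  same_law X X' -> measurable B ->
  P ((fun w => X t w - X s w) @^-1` B) = P' ((fun w => X' t w - X' s w) @^-1` B).
Proof. by move=> XX' mB; exact: XX' _ (path_measurable_increment s t mB). Qed.

Lemma gaussian_increment d (T : measurableType d) (P : probability T R)
    (X : 'rV[R]_N -> {RV P >-> R}) s t :
  gaussian_field X -> is_gaussian P (X t \- X s).
Proof.
move=> gX; have := gX 2%N (fun i => if i == ord0 then t else s)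
  (fun i => if i == ord0 then 1 else -1).
congr (is_gaussian P _); apply/funext => w.
by rewrite !big_ord_recl big_ord0/= addr0 mul1r mulN1r.
Qed.

End increments.

(** * Increments of the copies, energies of their images and modulus of continuity *)

Section field.
Variable R : realType.
Variables (N p : nat) (H : 'I_N -> R) (H_bounds : forall j, 0 < H j <= 1).
Context d0 (T0 : measurableType d0) (P0 : probability T0 R).
Variables (X : 'rV[R]_N -> {RV P0 >-> R}) (X_gaussian : gaussian_field X).
Context d (T : measurableType d) (P : probability T R).
Variables (Xs : 'I_p -> 'rV[R]_N -> {RV P >-> R}).
Hypothesis Xs_copies : forall i, same_law (Xs i) X.
Hypothesis Xs_independent : independent_fields Xs.
Hypothesis Xs_continuous : forall i, continuous_field (Xs i).
Variables (delta0 c11 : R) (delta0_gt0 : 0 < delta0) (c11_ge1 : 1 <= c11).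
Hypothesis X_increments : forall s t : 'rV[R]_N,
  unit_cube s -> unit_cube t -> euclid_dist s t <= delta0 ->
  (((c11^-1 * aniso_sum H s t)%:E <= 'E_P0[fun w => ((X t w - X s w) ^+ 2)%R])%E /\
   ('E_P0[fun w => ((X t w - X s w) ^+ 2)%R] <= (c11 * aniso_sum H s t)%:E)%E).

Local Notation index m := {dffun forall j : 'I_N, 'I_(mesh H m j).+1}.

Lemma measurable_gt_increment i s t (r : R) :
  measurable [set w | r < `|Xs i t w - Xs i s w|].
Proof.
rewrite [X in measurable X](_ : _ = (Xs i t \- Xs i s) @^-1` [set x | r < `|x|])//.
by rewrite -[X in measurable X]setTI;
  apply: (measurable_funP (Xs i t \- Xs i s)) => //; exact: measurable_gt_norm.
Qed.

Lemma copies_tail (q : nat) s t (v r : R) i : 0 < v ->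
  ('E_P0[fun w => ((X t w - X s w) ^+ 2)%R] <= v%:E)%E -> 0 < r ->
  (P [set w | (r < `|Xs i t w - Xs i s w|)%R] <=
    (2 * (44 ^+ 2 * q.+1%:R * v / r ^+ 2) ^+ q.+1)%:E)%E.
Proof.
move=> v0 vX r0; have mr := measurable_gt_norm r.
rewrite [X in P X](_ : _ = (fun w =>
  Xs i t w - Xs i s w) @^-1` [set x | r < `|x|])//.
rewrite (same_law_increment s t (Xs_copies i) mr).
exact: (@gaussian_tail _ _ _ _ q (X t \- X s) v r (gaussian_increment _ _ X_gaussian)).
Qed.

(** By independence the probability is a product over the [p] fields, each factor being computed
    from the law of [X]. *)
Lemma copies_small_ball s t (v r : R) : 0 < v ->
  (v%:E <= 'E_P0[fun w => ((X t w - X s w) ^+ 2)%R])%E -> 0 <= r ->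
  (P [set w | forall i, (`|Xs i t w - Xs i s w| <= r)%R] <=
    ((24 * r / Num.sqrt v) ^+ p)%:E)%E.
Proof.
move=> v0 vX r0.
pose B := `[(- r)%R, r]%classic : set R.
have mB : measurable B by exact: measurable_itv.
have := @Xs_independent [set: 'I_p]%SET (fun _ => increment_set s t B)
  (fun i _ => path_measurable_increment s t mB).
set A := \bigcap_(i in _) _.
have -> : [set w | forall i, (`|Xs i t w - Xs i s w| <= r)%R] = A.
  have hE i w : (sample_path (Xs i) @^-1` increment_set s t B) w <->
      `|Xs i t w - Xs i s w| <= r.
    change (Xs i t w - Xs i s w \in `[- r, r] <-> `|Xs i t w - Xs i s w| <= r).
    by rewrite in_itv/= -ler_norml.
  apply/seteqP; split=> w /= h i; first by move=> _; apply/hE.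
  exact/hE/h/finset.in_setT.
have mAi i : measurable ((fun w => Xs i t w - Xs i s w) @^-1` B).
  rewrite -[X in measurable X]setTI.
  by apply: (measurable_funP (Xs i t \- Xs i s)).
have mA : measurable A.
  by apply: fin_bigcap_measurable => // i _; exact: mAi.
move=> PA; rewrite -(fineK (fin_num_measure P _ mA)) lee_fin PA.
rewrite (eq_bigl xpredT); last by move=> i; rewrite inE.
rewrite -[X in _ ^+ X]card_ord -prodr_const; apply: ler_prod => i _.
rewrite fine_ge0//= -lee_fin fineK; last exact/fin_num_measure/mAi.
apply: (@le_trans _ _ (P0 ((fun w => X t w - X s w) @^-1` B))).
  by rewrite -(same_law_increment s t (Xs_copies i) mB).
exact: (@gaussian_small_ball _ _ _ _ (X t \- X s) v r (gaussian_increment _ _ X_gaussian)).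
Qed.

Definition close_event n s t : set T :=
  [set w | forall i, `|Xs i t w - Xs i s w| <= 2 ^- n].

Lemma measurable_close_event n s t : measurable (close_event n s t).
Proof.
rewrite (_ : close_event n s t = \bigcap_(i in [set: 'I_p])
   ((Xs i t \- Xs i s) @^-1` `[(- 2 ^- n)%R, 2 ^- n]%classic)).
  apply: fin_bigcap_measurable => // i _.
  by rewrite -[X in measurable X]setTI; apply: (measurable_funP (Xs i t \- Xs i s)).
apply/seteqP; split=> w h i; first by move=> _; rewrite /= in_itv/= -ler_norml.
by have := h i I; rewrite /= in_itv/= -ler_norml.
Qed.

(** One term suffices, that of the least [k] whose condition holds. For [k = 0] it is at least 1.
    For [k > 0] the condition fails at [k - 1] in some coordinate, so the increments have root mean
    square at least [2^(k - 1 - n) / c11]; the shift by 1 turns the 24 of the small ball bound into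
    48. *)
Lemma close_event_prob n s t : unit_cube s -> unit_cube t ->
  euclid_dist s t <= delta0 ->
  fine (P (close_event n s t)) <= \sum_(k < n.+1)
   [forall j, `|s 0 j - t 0 j| <= 2 `^ (- ((n - k)%:R / H j))]%:R *
     ((48 * c11) ^+ p * (2 ^- k) ^+ p).
Proof.
move=> us ut st; have c110 : 0 < c11 by apply: lt_le_trans c11_ge1.
pose Q k := [forall j, `|s 0 j - t 0 j| <= 2 `^ (- ((n - k)%:R / H j))].
have exQ : exists k, Q k.
  exists n; apply/forallP => j; rewrite subnn mul0r oppr0 powRr0.
  have /andP[] := us j; have /andP[] := ut j => h1 h2 h3 h4.
  by rewrite ler_norml; apply/andP; split; lra.
case: (ex_minnP exQ) => k Qk kmin.
have kn : (k <= n)%N.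
  rewrite leqNgt; apply/negP => nk.
  have : Q n.
    apply/forallP => j; have /forallP/(_ j) := Qk.
    by rewrite subnn (eqP (ltnW nk : n - k == 0)%N).
  by move=> /kmin; rewrite leqNgt nk.
have terms_ge0 (k' : 'I_n.+1) : 0 <= (Q k')%:R * ((48 * c11) ^+ p * (2 ^- k') ^+ p).
  by rewrite !mulr_ge0 ?exprn_ge0 ?mulr_ge0// ?ltW// invr_ge0 exprn_ge0.
have kn' : (k < n.+1)%N by [].
rewrite (bigD1 (Ordinal kn'))//= -/(Q k) Qk mul1r.
apply: ler_wpDr; first by apply: sumr_ge0 => k' _; exact: terms_ge0.
have mE := measurable_close_event n s t.
have P1 : fine (P (close_event n s t)) <= 1.
  by rewrite -lee_fin fineK ?fin_num_measure// probability_le1.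
case: k => [|k] in kn kmin Qk {kn'} *.
  apply: le_trans P1 _; rewrite expr0 invr1 expr1n mulr1.
  by apply: exprn_ege1; move: c11_ge1; lra.
have : ~~ Q k by apply/negP => /kmin; rewrite ltnn.
rewrite negb_forall => /existsP[j]; rewrite -ltNge => Hj.
set b := (n - k)%:R in Hj.
have /andP[Hj0 Hj1] := H_bounds j.
have aniso : 2 `^ (- b) ^+ 2 <= aniso_sum H s t.
  rewrite /aniso_sum (bigD1 j)//=; apply: ler_wpDr.
    by apply: sumr_ge0 => l _; exact: powR_ge0.
  rewrite (mulrC 2) powRrM powR_mulrn ?powR_ge0// ler_sqr ?nnegrE ?powR_ge0//.
  have -> : 2 `^ (- b) = (2 `^ (- (b / H j))) `^ H j.
    by rewrite -powRrM mulNr divfK ?gt_eqF.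
  by apply: ge0_ler_powR; rewrite ?nnegrE ?powR_ge0 ?normr_ge0 ?(ltW Hj0) ?(ltW Hj).
pose u := 2 `^ (- b) / c11.
have u0 : 0 < u by rewrite divr_gt0 ?powR_gt0.
have uE : ((u ^+ 2)%:E <= 'E_P0[fun w => ((X t w - X s w) ^+ 2)%R])%E.
  apply: le_trans (X_increments us ut st).1; rewrite lee_fin.
  apply: (@le_trans _ _ (c11^-1 * 2 `^ (- b) ^+ 2)); last first.
    by rewrite ler_wpM2l// invr_ge0 ltW.
  rewrite /u exprMn mulrC ler_wpM2r ?sqr_ge0// exprVn lef_pV2 ?posrE ?exprn_gt0//.
  by rewrite ler_eXnr.
have := copies_small_ball (exprn_gt0 2 u0) uE
  (_ : 0 <= 2 ^- n).
rewrite invr_ge0 exprn_ge0// => /(_ isT) h.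
rewrite -lee_fin fineK ?fin_num_measure//; apply: le_trans h _.
rewrite lee_fin sqrtr_sqr gtr0_norm// -exprMn.
rewrite le_eqVlt; apply/orP; left; apply/eqP; congr (_ ^+ p).
have -> : 2 ^- n = 2 `^ (- b) * 2 ^- k :> R.
  by rewrite !powR2N -powR2D /b natrB ?(ltnW kn)//; congr (_ `^ _); ring.
have b0 : 0 < 2 `^ (- b) :> R by rewrite powR_gt0.
have -> : 2 ^- k.+1 = 2^-1 * 2 ^- k :> R by rewrite exprS invfM.
rewrite /u; move: (2 ^- k) (2 `^ (- b)) b0 => x y y0.
by field; rewrite !gt_eqF.
Qed.

Lemma hausdorff_dim_image_ge q (F : T -> 'rV[R]_N -> 'rV[R]_q) (L : nat)
    (D0 gamma : R) : (L <= 1)%N -> 0 < gamma < D0 ->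
  {ae P, forall w, continuous (F w)} ->
  (forall w s t n, unit_cube s -> unit_cube t ->
     (forall l, `|F w s 0 l - F w t 0 l| <= 2 ^- n) ->
     close_event n s t w /\ window L n s t) ->
  (forall b k, D0 * (b + k)%:R <=
     \sum_j Num.max (L * (b + k))%:R (b%:R / H j) + (k * p)%:R) ->
  {ae P, forall w, (gamma%:E <= hausdorff_dim (F w @` @unit_cube R N))%E}.
Proof.
move=> L1 /andP[g0 gD0] Fcont Fclose gD.
(* Makes every pair of grid points closer than [delta0]. *)
pose a := Num.min 1 (delta0 / N.+1%:R).
have a0 : 0 < a by rewrite lt_min ltr01 divr_gt0.
have a01 : 0 <= a <= 1 by rewrite ltW//= ge_min lexx.
have ad : N.+1%:R * a <= delta0.
  by rewrite mulrC -ler_pdivlMr// ge_min lexx orbT.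
pose nj m j := Num.truncn (2 `^ (m%:R / H j)).
have njH m j : 2 `^ (m%:R / H j) <= 2 * (nj m j)%:R.
  have h1 : 1 <= 2 `^ (m%:R / H j).
    by case/andP: (H_bounds j) => Hj0 _; rewrite powR2_ge1// divr_ge0// ltW.
  have h2 := truncnS_gt (2 `^ (m%:R / H j)).
  have : (0 < nj m j)%N by rewrite truncn_gt0.
  rewrite -(ler_nat R) => h3.
  rewrite -natr1 -/(nj m j) in h2; lra.
pose I m : finType := {dffun forall j, 'I_(nj m j)}.
have I0 m : (0 < #|I m|)%N.
  rewrite -(ltr_nat R) card_grid prodr_gt0// => j _.
  by case/andP: (H_bounds j) => Hj0 _;
    rewrite ltr0n truncn_gt0 powR2_ge1// divr_ge0// ltW.
pose gp m (i : I m) : 'rV[R]_N := grid_point a i.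
have gpc m i : unit_cube (@gp m i) by exact: grid_point_cube.
have gpd m (i i' : I m) : euclid_dist (gp m i) (gp m i') <= delta0.
  apply: le_trans ad; apply: euclid_dist_le_coord; first exact: ltW.
  by move=> j; exact: grid_point_dist.
pose K := (48 * c11) ^+ p * (2 + 2 / a) ^+ N.
have c48 : 0 <= (48 * c11) ^+ p by rewrite exprn_ge0 ?mulr_ge0// (le_trans ler01).
have K0 : 0 <= K.
  by rewrite mulr_ge0// exprn_ge0// addr_ge0// divr_ge0// ltW.
pose x := 2 `^ (gamma - D0).
have x01 : 0 <= x < 1.
  by rewrite powR_ge0/= powR2_lt1// subr_lt0.
pose W m n (i i' : I m) := window L n (gp m i) (gp m i').
pose J m : finType := ('I_m.+1 * (I m * I m))%type.
pose c m (y : J m) : R :=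
  (W m y.1 y.2.1 y.2.2)%:R / (2 ^- y.1) `^ gamma / #|I m|%:R ^+ 2.
pose A m (y : J m) := close_event y.1 (gp m y.2.1) (gp m y.2.2).
have c0 m y : 0 <= c m y.
  by rewrite divr_ge0 ?exprn_ge0// divr_ge0 ?powR_ge0.
have mA m y : measurable (A m y) by exact: measurable_close_event.
(* The discrete [gamma]-energy of the image of the grid of level [m], over the scales up to [m],
   divided by the number of pairs. *)
pose f m w : \bar R := (\sum_y c m y * \1_(A m y) w)%:E.
have mf m : measurable_fun setT (f m).
  apply/measurable_EFinP; apply: measurable_sum => y.
  by apply: measurable_funM => //; exact: measurable_indic.
have f0 m w : (0 <= f m w)%E.
  by rewrite lee_fin sumr_ge0// => y _; rewrite mulr_ge0// indicE.
have fC m : (\int[P]_w f m w <= (K * (1 - x) ^- 2)%:E)%E.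
  rewrite integral_sum_indic// lee_fin.
  pose pr (n : 'I_m.+1) (i i' : I m) : R :=
    (W m n i i')%:R * fine (P (close_event n (gp m i) (gp m i'))).
  have -> : \sum_y c m y * fine (P (A m y)) =
      \sum_(n < m.+1) (\sum_i \sum_i' pr n i i') / (2 ^- n) `^ gamma / #|I m|%:R ^+ 2.
    under [RHS]eq_bigr do rewrite pair_big/= !mulr_suml.
    rewrite pair_big/=; apply: eq_bigr => -[n [i i']] _ /=.
    by rewrite /c /A /pr /=; ring.
  have I20 : 0 < #|I m|%:R ^+ 2 :> R by rewrite exprn_gt0// ltr0n.
  apply: (@le_trans _ _ (\sum_(n < m.+1) K * (n.+1%:R * x ^+ n))); last first.
    by rewrite -mulr_sumr ler_wpM2l// sum_arith_geometric.
  apply: ler_sum => n _; rewrite ler_pdivrMr// ler_pdivrMr ?powR_gt0 ?invr_gt0 ?exprn_gt0//.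
  have nm : (n <= m)%N by rewrite -ltnS.
  have := grid_energy H_bounds L1 nm a0 c48 (njH m) gD (pr := pr n).
  move=> /(_ _)/le_trans; apply.
    move=> i i'; rewrite /pr ler_wpM2l//.
    exact: close_event_prob.
  (* The gap [D0 - gamma > 0] turns the counting bound into a summable one. *)
  have -> : 2 `^ (- (D0 * n%:R)) = x ^+ n * (2 ^- n) `^ gamma :> R.
    rewrite /x -powR_mulrn ?powR_ge0// powR2N -!powRrM -powR2D.
    by congr (_ `^ _); ring.
  by rewrite le_eqVlt; apply/orP; left; apply/eqP; rewrite /K; ring.
have often := ae_bounded_often mf f0 fC.
apply: filterS2 Fcont often => w Fw [M [M0 fM]].
apply: (@hausdorff_dim_ge _ _ _ gamma M) => //.
  apply: continuous_compact; first exact: continuous_subspaceT.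
  exact: compact_unit_cube.
move=> n0; have [m [nm fm]] := fM n0.
exists m, (I m), (fun i => F w (gp m i)); split => //.
  by move=> i; exists (gp m i).
move: fm; rewrite lee_fin => fm.
have I20 : 0 < #|I m|%:R ^+ 2 :> R by rewrite exprn_gt0// ltr0n.
rewrite -ler_pdivrMr//; apply: le_trans fm.
under eq_bigr do rewrite pair_big/=.
rewrite pair_big/= mulr_suml; apply: ler_sum => -[n [i i']] _ /=.
case: asboolP => [close|_]; last first.
  by rewrite !mul0r mulr_ge0 ?c0// indicE.
have [Ew Ww] := Fclose _ _ _ _ (gpc m i) (gpc m i') close.
by rewrite /c /A /W /= Ww indicE mem_set// mulr1.
Qed.

Lemma near_nodes_aniso m (s t : 'rV[R]_N) : near_nodes H m s t ->
  aniso_sum H s t <= 9 * N.+1%:R * (2 ^- m) ^+ 2.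
Proof.
move=> /forallP st; apply: (@le_trans _ _ (\sum_(j < N) 9 * (2 ^- m) ^+ 2)).
  apply: ler_sum => j _; have /andP[Hj0 Hj1] := H_bounds j.
  rewrite (mulrC 2) powRrM powR_mulrn ?powR_ge0//.
  have -> : 9 * (2 ^- m) ^+ 2 = (3 * 2 ^- m) ^+ 2 :> R by ring.
  rewrite ler_sqr ?nnegrE ?powR_ge0 ?mulr_ge0 ?invr_ge0 ?exprn_ge0//.
  apply: (@le_trans _ _ ((3 * 2 `^ (- (m%:R / H j))) `^ H j)).
    by apply: ge0_ler_powR; rewrite ?nnegrE ?(ltW Hj0)// ?mulr_ge0 ?powR_ge0//;
      exact: st.
  rewrite powRM ?powR_ge0// -powRrM mulNr divfK ?gt_eqF// -powR2N ler_wpM2r//.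
  by rewrite ler1_powR// ler1n.
rewrite sumr_const card_ord -[leLHS]mulr_natl mulrA ler_wpM2r ?sqr_ge0//.
by rewrite mulrC ler_wpM2l// ler_nat.
Qed.

Lemma near_nodes_euclid m (s t : 'rV[R]_N) : near_nodes H m s t ->
  euclid_dist s t <= 3 * N.+1%:R * 2 ^- m.
Proof.
move=> /forallP st; have -> : 3 * N.+1%:R * 2 ^- m = N.+1%:R * (3 * 2 ^- m) :> R by ring.
apply: euclid_dist_le_coord; first by rewrite mulr_ge0 ?invr_ge0 ?exprn_ge0.
move=> j; apply: le_trans (st j) _; rewrite ler_pM2l//; exact: mesh_side_le.
Qed.

Lemma card_mesh m : #|{: index m}|%:R <= 3 ^+ N * 2 `^ (m%:R * \sum_j (H j)^-1) :> R.
Proof.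
rewrite mulr_sumr; apply: (card_pow2_ceil (e := fun j => m%:R / H j)) => j.
by case/andP: (H_bounds j) => Hj0 _; rewrite divr_ge0// ltW.
Qed.

(** Failure at level [m] of the increment bound assumed by [chaining]. *)
Definition bad_event i (rho : R) m : set T :=
  [set w | exists y : index m.+1 * index m,
     near_nodes H m (grid_node y.1) (grid_node y.2) /\
     rho ^+ m < `|Xs i (grid_node y.1) w - Xs i (grid_node y.2) w|].

(** There are about [2^(2 m Q)] pairs of nodes. The threshold [rho^m] exceeds the typical increment
    [2^-m] by a factor [2^(eps m)], so a tail bound of order [q.+1] gives [2^(-2 m eps q.+1)] per
    pair; [q] is chosen with [eps q.+1 >= Q + 1]. *)
Lemma bad_event_prob i (eps : R) : 0 < eps -> exists C m1, 0 <= C /\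
  forall m, (m1 <= m)%N -> measurable (bad_event i (2 `^ (eps - 1)) m) /\
   (P (bad_event i (2 `^ (eps - 1)) m) <= (C * 2 ^- m)%:E)%E.
Proof.
move=> e0; set rho := 2 `^ (eps - 1); set Q := \sum_j (H j)^-1.
have Q0 : 0 <= Q.
  by apply: sumr_ge0 => j _; case/andP: (H_bounds j) => Hj _; rewrite invr_ge0 ltW.
pose q := Num.truncn ((Q + 1) / eps).
have qQ : Q + 1 <= eps * q.+1%:R.
  by rewrite -ler_pdivrMl// mulrC ltW// truncnS_gt.
pose B := 44 ^+ 2 * q.+1%:R * (c11 * (9 * N.+1%:R)).
have c110 : 0 < c11 by apply: lt_le_trans c11_ge1.
have B0 : 0 <= B by rewrite !mulr_ge0// ltW.
pose C := 2 * B ^+ q.+1 * (3 ^+ N * 2 `^ Q) * 3 ^+ N.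
(* From level [m1] on, near nodes are within [delta0] of each other. *)
have [m1 m1P] : exists m1, 2 ^- m1 < delta0 / (3 * N.+1%:R).
  by apply: exists_pow2N_lt; rewrite divr_gt0// mulr_gt0.
exists C, m1; split.
  by rewrite !mulr_ge0 ?exprn_ge0 ?powR_ge0.
move=> m m1m.
pose A (y : index m.+1 * index m) : set T :=
  if near_nodes H m (grid_node y.1) (grid_node y.2) then
    [set w | rho ^+ m < `|Xs i (grid_node y.1) w - Xs i (grid_node y.2) w|] else set0.
have mA y : measurable (A y).
  by rewrite /A; case: ifP => // _; exact: measurable_gt_increment.
have badE : bad_event i rho m = [set w | exists y, A y w].
  apply/seteqP; split=> w [y].
    by move=> [near far]; exists y; rewrite /A near.
  by rewrite /A; case: ifPn => // near far; exists y.
split.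
  by rewrite badE; exact: measurable_exists_fin.
rewrite badE; apply: le_trans (Boole_fin _ mA) _.
set b := 2 * B ^+ q.+1 * 2 `^ (- (2 * m%:R * (Q + 1))).
have Ab y : (P (A y) <= b%:E)%E.
  rewrite /A; case: ifP => near; last
    by rewrite measure0 lee_fin !mulr_ge0 ?exprn_ge0 ?powR_ge0.
  have v0 : 0 < c11 * (9 * N.+1%:R * (2 ^- m) ^+ 2).
    by rewrite !mulr_gt0// ?exprn_gt0// invr_gt0 exprn_gt0.
  have rho0 : 0 < rho ^+ m by rewrite exprn_gt0// powR_gt0.
  have uy1 : unit_cube (grid_node y.1 : 'rV[R]_N) by exact: grid_node_cube.
  have uy2 : unit_cube (grid_node y.2 : 'rV[R]_N) by exact: grid_node_cube.
  have near' : near_nodes H m (grid_node y.2) (grid_node y.1).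
    by apply/forallP => j; rewrite distrC; exact: (forallP near).
  apply: le_trans (copies_tail q i v0 _ rho0) _.
    apply: le_trans (X_increments uy2 uy1 _).2 _.
      apply: le_trans (near_nodes_euclid near') _.
      rewrite mulrC -ler_pdivlMr ?mulr_gt0//; apply: le_trans (ltW m1P).
      by rewrite lef_pV2 ?posrE ?exprn_gt0// ler_eXn2l ?ltr1n.
    by rewrite lee_fin ler_pM2l// near_nodes_aniso.
  rewrite lee_fin /b -[leRHS]mulrA ler_pM2l//.
  have -> : 44 ^+ 2 * q.+1%:R * (c11 * (9 * N.+1%:R * 2 ^- m ^+ 2)) / rho ^+ m ^+ 2 =
     B * (2 `^ (- eps * m%:R)) ^+ 2.
    have -> : 2 ^- m = rho ^+ m * 2 `^ (- eps * m%:R) :> R.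
      rewrite /rho powR2N -powR_mulrn ?powR_ge0// -powRrM -powR2D.
      by congr (_ `^ _); ring.
    rewrite /B; move: (rho ^+ m) rho0 => r r0; field; rewrite gt_eqF//.
  rewrite exprMn ler_wpM2l ?exprn_ge0//.
  rewrite -exprM -powR_mulrn ?powR_ge0// -powRrM ler_powR ?ler1n// natrM.
  have := ler_wpM2l (_ : 0 <= 2 * m%:R) qQ; rewrite mulr_ge0// => /(_ isT); lra.
apply: le_trans (lee_sum _ (fun y _ => Ab y)) _.
rewrite sumEFin lee_fin sumr_const card_prod -[leLHS]mulr_natr natrM.
apply: (@le_trans _ _ (b * ((3 ^+ N * 2 `^ (m.+1%:R * Q)) * (3 ^+ N * 2 `^ (m%:R * Q))))).
  rewrite ler_wpM2l//; first by rewrite !mulr_ge0 ?exprn_ge0 ?powR_ge0.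
  by rewrite ler_pM ?card_mesh.
have -> : C * 2 ^- m = 2 * B ^+ q.+1 * 3 ^+ N * 3 ^+ N * (2 `^ Q * 2 ^- m)
  by rewrite /C; ring.
rewrite /b (_ : _ * (_ * _) = 2 * B ^+ q.+1 * 3 ^+ N * 3 ^+ N *
  (2 `^ (- (2 * m%:R * (Q + 1))) * 2 `^ (m.+1%:R * Q) * 2 `^ (m%:R * Q)));
    last by ring.
rewrite ler_wpM2l ?mulr_ge0 ?exprn_ge0//.
rewrite powR2N -!powR2D ler_powR ?ler1n// -natr1.
have m0 : 0 <= m%:R :> R by [].
lra.
Qed.

(** By Borel-Cantelli only finitely many bad events occur almost surely; [chaining] applies beyond
    the last one. *)
Lemma modulus_of_continuity i (eps : R) : 0 < eps < 1 ->
  {ae P, forall w, exists m0, forall m s t, (m0 <= m)%N ->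
     unit_cube s -> unit_cube t ->
     (forall j, `|s 0 j - t 0 j| <= 2 `^ (- (m%:R / H j))) ->
     `|Xs i s w - Xs i t w| <=
       (1 + 2 / (1 - 2 `^ (eps - 1))) * (2 `^ (eps - 1)) ^+ m}.
Proof.
move=> /andP[e0 e1]; set rho := 2 `^ (eps - 1).
have rho01 : 0 < rho < 1 by rewrite powR_gt0//= powR2_lt1// subr_lt0.
have [C [m1 [C0 bad]]] :=
  bad_event_prob i e0.
pose B m := bad_event i rho (m + m1).
have mB m : measurable (B m) by apply: (bad _ _).1; exact: leq_addl.
have PB : P (lim_sup_set B) = 0%E.
  apply: lim_sup_set_cvg0 => //.
  apply: (@le_lt_trans _ _ (2 * C)%:E); last exact: ltry.
  apply: nneseries_le_bound => // k.
  apply: (@le_trans _ _ (\sum_(0 <= m < k) (2 * C * 2 ^- m.+1)%:E)%E).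
    apply: lee_sum => m _; apply: le_trans (bad (m + m1)%N (leq_addl _ _)).2 _.
    rewrite lee_fin; apply: (@le_trans _ _ (C * 2 ^- m)).
      rewrite ler_wpM2l// lef_pV2 ?posrE ?exprn_gt0//.
      by rewrite ler_eXn2l ?ltr1n// leq_addr.
    by rewrite exprS invfM (mulrC 2 C) -mulrA mulVKf.
  rewrite sumEFin lee_fin big_mkord -mulr_sumr ler_piMr ?mulr_ge0//.
  exact: sum_half_powers.
have goodB : {ae P, forall w, ~ lim_sup_set B w}.
  exists (lim_sup_set B); split => //.
    apply: bigcap_measurable => // n _; exact: bigcup_measurable.
  by move=> w /= /contrapT.
apply: filterS2 (Xs_continuous i) goodB => w cw.
rewrite /lim_sup_set /bigcap/= => /existsNP[n /not_implyP[_ nB]].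
exists (n + m1)%N; apply: chaining => // m nm k k' near.
rewrite leNgt; apply/negP => far; apply: nB; exists (m - m1)%N => /=.
  by rewrite leq_subRL; [rewrite addnC|exact: leq_trans (leq_addl _ _) nm].
rewrite /B subnK; last exact: leq_trans (leq_addl _ _) nm.
by exists (k, k').
Qed.

(** * Almost sure dimension, for the range and the graph together *)

Variables (q L : nat) (F : T -> 'rV[R]_N -> 'rV[R]_q).
Hypothesis L1 : (L <= 1)%N.
Hypothesis F_continuous : forall w, (forall i, continuous (sample_path (Xs i) w)) ->
  continuous (F w).
Hypothesis F_close : forall w s t n, unit_cube s -> unit_cube t ->
  (forall l, `|F w s 0 l - F w t 0 l| <= 2 ^- n) <->
  close_event n s t w /\ window L n s t.

Lemma ae_continuous : {ae P, forall w i, continuous (sample_path (Xs i) w)}.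
Proof. exact: filter_forall. Qed.

Lemma ae_hausdorff_dim_le (theta s : R) : 0 < theta <= 1 -> exponent p H L theta < s ->
  {ae P, forall w, (hausdorff_dim (F w @` @unit_cube R N) <= s%:E)%E}.
Proof.
move=> th01 ths.
(* The loss [p * eps] in the covering count stays below the margin left by [s]. *)
pose eps := Num.min (1 / 2) ((s - exponent p H L theta) / (2 * p.+1%:R)).
have eps01 : 0 < eps < 1.
  rewrite lt_min !divr_gt0 ?mulr_gt0 ?subr_gt0//= gt_min; apply/orP; left; lra.
have peps : exponent p H L theta + p%:R * eps < s.
  have /andP[e0 _] := eps01.
  have : eps * (2 * p.+1%:R) <= s - exponent p H L theta.
    by rewrite -ler_pdivlMr ?mulr_gt0// ge_min lexx orbT.
  have : 0 <= p%:R * eps by rewrite mulr_ge0// ltW.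
  rewrite -[p.+1%:R]natr1; lra.
apply: filterS (filter_forall _ (fun i => modulus_of_continuity i eps01)).
move=> w mod_w.
have [m0 m0P] := choice mod_w.
pose C := 1 + 2 / (1 - 2 `^ (eps - 1)) : R.
have /andP[_ eps1] := eps01.
have rho1 : 2 `^ (eps - 1) < 1 :> R by rewrite powR2_lt1// subr_lt0.
have C1 : 1 <= C by rewrite lerDl divr_ge0// subr_ge0 ltW.
apply: (hausdorff_dim_image_le_exponent (x := fun i t => Xs i t w) (C := C)
  (m0 := \max_i m0 i) H_bounds eps01 C1 _ _ th01 peps) => //.
  move=> i m s' t mm; apply: m0P; apply: leq_trans mm; exact: leq_bigmax.
move=> s' t n us ut cl win; apply/F_close => //; split => // i.
by rewrite distrC.
Qed.

(** Covers are available only for [theta > 0], while the exponent may be minimal at 0; hence the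
    approximation within [eta]. *)
Lemma ae_hausdorff_dim (D : R) : 0 < D ->
  (forall theta : R, 0 <= theta <= 1 -> D <= exponent p H L theta) ->
  (forall eta : R, 0 < eta -> exists theta : R, 0 < theta <= 1 /\
     exponent p H L theta <= D + eta) ->
  {ae P, forall w, hausdorff_dim (F w @` @unit_cube R N) = D%:E}.
Proof.
move=> D0 Dle Dge.
(* Bounds along a sequence, so that the exceptional null sets are countably many. *)
have upper n : {ae P, forall w,
    (hausdorff_dim (F w @` @unit_cube R N) <= (D + 2 * n.+1%:R^-1)%:E)%E}.
  have [theta [th01 th]] := Dge n.+1%:R^-1 ltac:(by rewrite invr_gt0).
  apply: (@ae_hausdorff_dim_le theta) => //; apply: le_lt_trans th _.
  by rewrite ltrD2l ltr_pMl ?invr_gt0// ltr1n.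
(* With [n.+2] the exponent [gamma] lies strictly between 0 and [D] for every [n]. *)
have lower n : {ae P, forall w,
    ((D - D / n.+2%:R)%:E <= hausdorff_dim (F w @` @unit_cube R N))%E}.
  apply: (hausdorff_dim_image_ge L1 (D0 := D)).
  - rewrite subr_gt0 ltr_pdivrMr// ltr_pMr// ltr1n/= gtrBl divr_gt0//.
  - by apply: filterS ae_continuous => w cw; exact: F_continuous.
  - by move=> w s t n' us ut /F_close; apply.
  move=> b k; have [->|bk0] := eqVneq (b + k)%N 0%N.
    rewrite mulr0 addr_ge0// sumr_ge0// => j _; rewrite le_max muln0 lexx//.
  have bk : 0 < (b + k)%:R :> R by rewrite ltr0n lt0n.
  have th01 : 0 <= (b%:R / (b + k)%:R : R) <= 1.
    by rewrite divr_ge0//= ler_pdivrMr// mul1r ler_nat leq_addr.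
  (* The required inequality is [Dle] at [theta = b / (b + k)], multiplied by [b + k]. *)
  apply: le_trans (ler_wpM2r (ltW bk) (Dle _ th01)) _.
  rewrite /exponent mulrDl mulr_suml le_eqVlt; apply/orP; left; apply/eqP.
  congr (_ + _).
    apply: eq_bigr => j _; rewrite maxr_pMl ?(ltW bk)// natrM; congr Num.max.
    by rewrite mulrAC divfK ?gt_eqF.
  by rewrite mulrAC mulrBl divfK ?gt_eqF// mul1r natrD natrM; ring.
apply: filterS2 (ae_foralln upper) (ae_foralln lower) => w up lo.
apply/eqP; rewrite eq_le; apply/andP; split.
  apply/lee_addgt0Pr => e e0; rewrite -EFinD.
  have [n ne] : exists n, 2 * n.+1%:R^-1 <= e.
    exists (Num.truncn (2 / e)); rewrite ler_pdivrMr// mulrC -ler_pdivrMr//.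
    exact/ltW/truncnS_gt.
  by apply: le_trans (up n) _; rewrite lee_fin lerD2l.
apply/lee_addgt0Pr => e e0.
have [n ne] : exists n, D / n.+2%:R <= e.
  exists (Num.truncn (D / e)); rewrite ler_pdivrMr// mulrC -ler_pdivrMr//.
  by apply: le_trans (ltW (truncnS_gt _)) _; rewrite ler_nat.
apply: le_trans (_ : (((D - D / n.+2%:R) + e)%:E <= _)%E); last first.
  by rewrite EFinD leeD2r// lo.
by rewrite lee_fin -addrA lerDl addrC subr_ge0.
Qed.

End field.

(** * Dimensions of the range and of the graph *)

Theorem theorem5p1
  (R : realType) (N p : nat) (hN : (1 <= N)%N) (hp : (1 <= p)%N)
  (d0 : measure_display) (T0 : measurableType d0) (P0 : probability T0 R)
  (X : 'rV[R]_N -> {RV P0 >-> R})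
  (X_gaussian : gaussian_field X) (X_centered : centered_field X)
  (X_continuous : continuous_field X)
  (d : measure_display) (T : measurableType d) (P : probability T R)
  (Xs : 'I_p -> 'rV[R]_N -> {RV P >-> R})
  (Xs_copies : forall i, same_law (Xs i) X)
  (Xs_independent : independent_fields Xs)
  (Xs_continuous : forall i, continuous_field (Xs i))
  (H : 'I_N -> R) (H_bounds : forall j, 0 < H j <= 1)
  (H_nondecreasing : forall i j : 'I_N, (i <= j)%N -> H i <= H j)
  (delta0 c11 : R) (delta0_gt0 : 0 < delta0) (c11_ge1 : 1 <= c11)
  (X_increments : forall s t : 'rV[R]_N,
     unit_cube s -> unit_cube t -> euclid_dist s t <= delta0 ->
     ((c11^-1 * aniso_sum H s t)%:E <= 'E_P0[fun w =>
       ((X t w - X s w) ^+ 2)%R])%E /\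
     ('E_P0[fun w => ((X t w - X s w) ^+ 2)%R] <= (c11 * aniso_sum H s t)%:E)%E) :
  {ae P, forall w,
     hausdorff_dim (vector_field Xs w @` @unit_cube R N) =
       (Num.min p%:R (\sum_(j < N) (H j)^-1))%:E /\
     hausdorff_dim (graph_on (vector_field Xs w) (@unit_cube R N)) =
       Order.min
         (\big[Order.min/+oo%E]_(k < N)
            (\sum_(j < N | (j <= k)%N) H k / H j
               + (N - k.+1)%N%:R + (1 - H k) * p%:R)%:E)
         (\sum_(j < N) (H j)^-1)%:E}.
Proof.
set Q := \sum_(j < N) (H j)^-1.
have p0 : 0 < p%:R :> R by rewrite ltr0n.
have Q0 : 0 < Q.
  rewrite /Q (bigD1 (Ordinal hN))//=; apply: ltr_wpDr.
    by apply: sumr_ge0 => j _; case/andP: (H_bounds j) => Hj _;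
      rewrite invr_ge0 ltW.
  by case/andP: (H_bounds (Ordinal hN)) => Hj _; rewrite invr_gt0.
have range : {ae P, forall w, hausdorff_dim (vector_field Xs w @` @unit_cube R N) =
    (Num.min p%:R Q)%:E}.
  apply: (@ae_hausdorff_dim _ _ _ _ H_bounds _ _ _ _ X_gaussian _ _ _ _ Xs_copies
    Xs_independent Xs_continuous _ _ delta0_gt0 c11_ge1 X_increments _ 0%N) => //.
  - move=> w cw; apply: continuous_row => i.
    rewrite (_ : (fun t => _) = sample_path (Xs i) w); first exact: cw.
    by apply/funext => t; rewrite mxE.
  - move=> w s t n us ut; split=> [close|[close _] l].
      split=> [i|].
        by have := close i; rewrite !mxE distrC.
      apply/forallP => j; rewrite mul0n oppr0 powRr0.
      have /andP[s0 s1] := us j; have /andP[t0 t1] := ut j.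
      by rewrite ler_norml; apply/andP; split; lra.
    by rewrite !mxE distrC; exact: close.
  - by rewrite lt_min p0.
  (* For [L = 0] the exponent is affine, with value [p] at 0 and [Q] at 1. *)
  - move=> theta /andP[th0 th1]; rewrite exponent0E// -/Q ge_min.
    have [pQ|Qp] := leP p%:R Q; apply/orP; [left|right].
      have := ler_wpM2l th0 pQ; lra.
    have := ler_wpM2l (_ : 0 <= 1 - theta) (ltW Qp); rewrite subr_ge0 =>
      /(_ th1); lra.
  - move=> eta eta0; have [pQ|Qp] := leP p%:R Q; last first.
      exists 1; rewrite ltr01 lexx exponent0E// -/Q; split => //; lra.
    (* When [p <= Q] the minimum is at 0; this small positive [theta] exceeds it by at most
       [eta]. *)
    pose theta := Num.min 1 (eta / Q).
    have th0 : 0 < theta by rewrite lt_min ltr01 divr_gt0.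
    exists theta; rewrite th0 ge_min lexx exponent0E ?(ltW th0)// -/Q; split => //.
    have : theta * Q <= eta by rewrite -ler_pdivlMr// ge_min lexx orbT.
    have := mulr_gt0 th0 p0; lra.
have graph : {ae P, forall w,
    hausdorff_dim (graph_on (vector_field Xs w) (@unit_cube R N)) =
       Order.min
         (\big[Order.min/+oo%E]_(k < N)
            (\sum_(j < N | (j <= k)%N) H k / H j
               + (N - k.+1)%N%:R + (1 - H k) * p%:R)%:E) Q%:E}.
  have [D [theta [th01 DE Dmin ->]]] := graph_exponent H_bounds hp H_nondecreasing.
  apply: (@ae_hausdorff_dim _ _ _ _ H_bounds _ _ _ _ X_gaussian _ _ _ _ Xs_copies
    Xs_independent Xs_continuous _ _ delta0_gt0 c11_ge1 X_increments _ 1%N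
    (fun w t => row_mx t (vector_field Xs w t))) => //.
  - move=> w cw; apply: continuous_row => l.
    case: (split_ordP l) => j ->.
      rewrite (_ : (fun t => _) = fun t : 'rV[R]_N => t 0 j);
        first exact: coord_continuous.
      by apply/funext => t; rewrite row_mxEl.
    rewrite (_ : (fun t => _) = sample_path (Xs j) w); first exact: cw.
    by apply/funext => t; rewrite row_mxEr mxE.
  - move=> w s t n us ut; split=> [close|[close /forallP win] l].
      split=> [i|].
        by have := close (rshift N i); rewrite !row_mxEr !mxE distrC.
      apply/forallP => j; rewrite mul1n -powR2N.
      by have := close (lshift p j); rewrite !row_mxEl.
    case: (split_ordP l) => j ->.
      by rewrite !row_mxEl; have := win j; rewrite mul1n -powR2N.
    by rewrite !row_mxEr !mxE distrC; exact: close.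
  (* Positivity: for [L = 1] each maximum is at least 1, and [N >= 1] supplies a term. *)
  - rewrite DE /exponent.
    case/andP: th01 => th0 th1.
    rewrite ltr_wpDr ?mulr_ge0 ?subr_ge0//.
    rewrite (bigD1 (Ordinal hN))//=; apply: ltr_wpDr.
      by apply: sumr_ge0 => j _; rewrite le_max ler01.
    by rewrite lt_max ltr01.
  - by move=> eta eta0; exists theta; rewrite th01 -DE lerDl ltW.
by apply: filterS2 range graph => w.
Qed.
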